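(* Let $\phi=\psi^{-1}:\psi(U)\to\mathbb{R}^r$ be the inverse of a chart $\psi:U\to\mathbb{R}^n$ of an $n$-dimensional submanifold $M\subseteq\mathbb{R}^r$, $U$ small enough that the metric projection $\Pi^s$ is smoothly defined on a tubular neighbourhood of $U$, and let $\tilde\Pi^s=\psi\circ\Pi^s$. Let $$dx_t=\bar a(x_t,t)\,dt+b_\alpha(x_t,t)\circ dW^\alpha_t,\quad x_0\in U,\qquad dy_t=\bar A(y_t,t)\,dt+B_\alpha(y_t,t)\circ dW^\alpha_t,\quad y_0=\psi(x_0),$$ be Stratonovich SDEs on $\mathbb{R}^r$ and $\psi(U)\subseteq\mathbb{R}^n$, with $x_0$ deterministic, and extend them to negative times by $x_{-t}:=\xi_t$, $y_{-t}:=\eta_t$ ($t>0$), where $$d\xi_t=-\bar a(\xi_t,-t)\,dt-b_\alpha(\xi_t,-t)\circ d\hat W^\alpha_t,\ \ \xi_0=x_0,\qquad d\eta_t=-\bar A(\eta_t,-t)\,dt-B_\alpha(\eta_t,-t)\circ d\hat W^\alpha_t,\ \ \eta_0=y_0,$$ with $\hat W$ a standard Brownian motion independent of $W$. For maps $f,F$ put $z_t=f(x_t)-F(y_t)$ and $z_{-t}=f(\xi_t)-F(\eta_t)$, let $z^i_t$, $z^i_{-t}$ be their order $i$ It\^o--Taylor expansions, and let $$S_i(t)=\tfrac12E(|z^i_t|^2)+\tfrac12E(|z^i_{-t}|^2),\qquad t>0.$$ Then the Stratonovich projection is optimal in the following sense, both (i) for $f=\mathrm{id}$, $F=\phi$,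 and (ii) for $f=\tilde\Pi^s$, $F=\mathrm{id}$: minimizing $S_{1/2}(t)$ at every point requires $$B_\alpha(y,t)=(\psi_* )_{\phi(y)}\Pi_{\phi(y)}b_\alpha(\phi(y),t),$$ and, with $B$ so chosen, minimizing $S_1(t)$ over the drift requires choosing the Stratonovich drift by $$\bar A(y,t)=(\psi_* )_{\phi(y)}\Pi_{\phi(y)}\,\bar a(\phi(y),t).$$ Here the minimization determines the coefficients at the initial point and initial time, and it is imposed at every point (and time) taken as initial condition.
   Context: Einstein summation is used. $W=(W^1,\dots,W^m)$ are independent standard Brownian motions; $g_E^{\alpha\beta}=\delta^{\alpha\beta}$. $\circ\,dW$ is the Stratonovich differential; the It\^o drift $a$ equivalent to the Stratonovich drift $\bar a$ is $a=\bar a+\frac12\sum_\alpha b_\alpha^j\,\partial_jb_\alpha$ (similarly $A$ and $\bar A$ with $B$). The metric projection $\Pi^s$ sends a point of a tubular neighbourhood of $U$ to the nearest point of the submanifold. For $x\in M$, $\Pi_x:\mathbb{R}^r\to T_xM$ is the Euclidean orthogonal projection and $(\psi_* )_x:T_xM\to\mathbb{R}^n$ is the differential of $\psi$. The Stratonovich projection of the SDE for $x$ is by definition the Stratonovich SDE with coefficients $(\psi_* )\Pi_{\phi(y)}\bar a(\phi(y),t)$ and $(\psi_* )\Pi_{\phi(y)}b_\alpha(\phi(y),t)$. It\^o--Taylor expansions: consider an It\^o SDE $dZ_t=a(Z_t,t)dt+b_\alpha(Z_t,t)dW^\alpha_t$ (for functions of a pair such as $(x_t,y_t)$ or $(\xi_t,\eta_t)$,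 apply the following to the stacked SDE, written in It\^o form, driven by the same Brownian motions). A multi-index $\xi$ is a finite (possibly empty) list of integers in $\{0,\dots,m\}$; $l(\xi)$ is its length, $n(\xi)$ its number of zeros; $\xi_1,\xi_{-1}$ are its first and last entries, $-\xi$ and $\xi-$ the result of deleting the first, respectively last, entry. Put $W^0_t=t$. Define $I^{()}_{t_1,t_2}(f)=f(t_2)$ and $I^\xi_{t_1,t_2}(f)=\int_{t_1}^{t_2}I^{\xi-}_{t_1,s}(f)\,dW^{\xi_{-1}}_s$ otherwise. Define $L_{()}f=f$, $L_{(0)}f=\frac{\partial f}{\partial t}+a^i\frac{\partial f}{\partial x^i}+\frac12b^i_\alpha b^j_\beta g_E^{\alpha\beta}\frac{\partial^2f}{\partial x^i\partial x^j}$, $L_{(\alpha)}f=b^i_\alpha\frac{\partial f}{\partial x^i}$ for $\alpha\ge1$, and $L_\xi f=L_{(\xi_1)}(L_{-\xi}f)$ for $l(\xi)>1$. The It\^o--Taylor expansion of order $\gamma\in\{0,\frac12,1,\dots\}$ of $f(Z_t)$ (based at time $0$) is $\sum_{l(\xi)+n(\xi)\le2\gamma}(L_\xi f)|_{(0,Z_0)}\,I^\xi_{0,t}(1)$. Coefficients are assumed defined for times near $0$ of both signs, and all derivatives needed are assumed to exist. *)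

(* Defs.v *)
From HB Require Import structures.
From mathcomp Require Import all_boot all_order all_algebra.
From mathcomp Require Import all_classical all_reals all_analysis.

Set Implicit Arguments.
Unset Strict Implicit.
Unset Printing Implicit Defensive.

Import Order.TTheory GRing.Theory Num.Theory.
Import numFieldNormedType.Exports.

Local Open Scope classical_set_scope.
Local Open Scope ring_scope.

(** * Euclidean geometry of [R^N] *)

(* The library norm on row vectors is the sup norm, hence an explicit
   Euclidean inner product. *)
Definition dotv (R : realType) (N : nat) (u v : 'rV[R]_N) : R :=
  \sum_(i < N) u 0 i * v 0 i.

Definition sqnormv (R : realType) (N : nat) (u : 'rV[R]_N) : R := dotv u u.

Definition orth_proj (R : realType) (N : nat) (T : set 'rV[R]_N)
    (v : 'rV[R]_N) : 'rV[R]_N :=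
  xget 0 [set p | T p /\ forall u, T u -> dotv (v - p) u = 0].

(** * Submanifolds and charts *)

Fixpoint Ck (R : realType) (N p : nat) (k : nat) (O : set 'rV[R]_N)
    (f : 'rV[R]_N -> 'rV[R]_p) : Prop :=
  if k is k'.+1 then
    (forall x, O x -> differentiable f x) /\
    (forall v, Ck k' O (fun x => 'D_v f x))
  else forall x, O x -> {for x, continuous f}.

Definition smooth_on (R : realType) (N p : nat) (O : set 'rV[R]_N)
    (f : 'rV[R]_N -> 'rV[R]_p) : Prop :=
  forall k, Ck k O f.

(* Smoothness on a set that need not be open: local smooth extensions. *)
Definition smooth_on_subset (R : realType) (N p : nat) (U : set 'rV[R]_N)
    (f : 'rV[R]_N -> 'rV[R]_p) : Prop :=
  forall x, U x -> exists (O : set 'rV[R]_N) (h : 'rV[R]_N -> 'rV[R]_p),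
    [/\ open O, O x, smooth_on O h & forall z, U z -> O z -> h z = f z].

(* [psi] is a chart of [M] with domain [U], a relatively open subset of [M],
   and [phi] is its inverse.  The values of [psi] off [U] and of [phi] off
   [psi @` U] are irrelevant. *)
Definition is_chart (R : realType) (r n : nat) (M U : set 'rV[R]_r)
    (psi : 'rV[R]_r -> 'rV[R]_n) (phi : 'rV[R]_n -> 'rV[R]_r) : Prop :=
  [/\ exists O : set 'rV[R]_r, open O /\ U = M `&` O,
      open (psi @` U),
      smooth_on_subset U psi,
      smooth_on (psi @` U) phi
    & forall x, U x -> phi (psi x) = x].

Definition is_submanifold (R : realType) (r : nat) (n : nat)
    (M : set 'rV[R]_r) : Prop :=
  forall x, M x -> exists (U : set 'rV[R]_r)
    (psi : 'rV[R]_r -> 'rV[R]_n) (phi : 'rV[R]_n -> 'rV[R]_r),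
    U x /\ is_chart M U psi phi.

Definition curve_through (R : realType) (r : nat) (M : set 'rV[R]_r)
    (x v : 'rV[R]_r) (gamma : R -> 'rV[R]_r) : Prop :=
  [/\ gamma 0 = x, \forall t \near (0 : R), M (gamma t)
    & is_derive (0 : R) (1 : R) gamma v].

Definition tangent_space (R : realType) (r : nat) (M : set 'rV[R]_r)
    (x : 'rV[R]_r) : set 'rV[R]_r :=
  [set v | exists gamma, curve_through M x v gamma].

(* [psi_* : T_x M -> R^n] at [x], the differential of the chart. *)
Definition push_forward (R : realType) (r n : nat) (M : set 'rV[R]_r)
    (psi : 'rV[R]_r -> 'rV[R]_n) (x v : 'rV[R]_r) : 'rV[R]_n :=
  xget 0 [set w | exists gamma, curve_through M x v gamma /\
                    is_derive (0 : R) (1 : R) (psi \o gamma) w].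

(* [N] is a tubular neighbourhood of [U] on which the metric projection [Pis],
   i.e. the map to the unique nearest point of [M], is smooth with values in
   [U] (so that [psi \o Pis] makes sense). *)
Definition is_metric_projection (R : realType) (r : nat)
    (M U N : set 'rV[R]_r) (Pis : 'rV[R]_r -> 'rV[R]_r) : Prop :=
  [/\ open N, U `<=` N, smooth_on N Pis
    & forall x, N x -> U (Pis x) /\
        forall q, M q -> q <> Pis x -> sqnormv (x - Pis x) < sqnormv (x - q)].

(** * Stochastic differential equations *)

(* Coefficients of an equation driven by [m] Brownian motions; whether they
   are meant in the Ito or in the Stratonovich sense is not recorded. *)
Record sde (R : realType) (m N : nat) := Sde {
  drift : 'rV[R]_N -> R -> 'rV[R]_N;
  diffusion : 'I_m -> 'rV[R]_N -> R -> 'rV[R]_N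
}.

Definition partial (R : realType) (N p : nat) (i : 'I_N)
    (f : 'rV[R]_N -> 'rV[R]_p) (x : 'rV[R]_N) : 'rV[R]_p :=
  'D_(delta_mx 0 i) f x.

(* [X] is an equation with state space [D], for times in [J], whose
   coefficients have the derivatives needed for the Stratonovich-to-Ito
   conversion and for the expansions of order at most 1. *)
Definition admissible (R : realType) (m N : nat) (D : set 'rV[R]_N)
    (J : set R) (X : sde R m N) : Prop :=
  forall alpha t x, J t -> D x ->
    differentiable (fun z => diffusion X alpha z t) x.

Definition ito_of_strat (R : realType) (m N : nat) (X : sde R m N) :
    sde R m N :=
  Sde (fun x t => drift X x t + 2^-1 *: \sum_(alpha < m) \sum_(j < N)
         diffusion X alpha x t 0 j *:
           partial j (fun z => diffusion X alpha z t) x)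
      (diffusion X).

(* The equation restarted at time [t0]. *)
Definition shift_sde (R : realType) (m N : nat) (t0 : R) (X : sde R m N) :
    sde R m N :=
  Sde (fun x t => drift X x (t0 + t))
      (fun alpha x t => diffusion X alpha x (t0 + t)).

(* The Stratonovich equation satisfied for [t > 0] by the extension of the
   solution to the time [- t]. *)
Definition reverse_sde (R : realType) (m N : nat) (X : sde R m N) :
    sde R m N :=
  Sde (fun x t => - drift X x (- t))
      (fun alpha x t => - diffusion X alpha x (- t)).

(* Both equations are driven by the same Brownian motions. *)
Definition stack_sde (R : realType) (m r n : nat) (X : sde R m r)
    (Y : sde R m n) : sde R m (r + n) :=
  Sde (fun z t => row_mx (drift X (lsubmx z) t) (drift Y (rsubmx z) t))
      (fun alpha z t => row_mx (diffusion X alpha (lsubmx z) t)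
                               (diffusion Y alpha (rsubmx z) t)).

Definition strat_projection (R : realType) (m r n : nat) (M : set 'rV[R]_r)
    (psi : 'rV[R]_r -> 'rV[R]_n) (phi : 'rV[R]_n -> 'rV[R]_r)
    (X : sde R m r) : sde R m n :=
  let proj y v :=
    push_forward M psi (phi y) (orth_proj (tangent_space M (phi y)) v) in
  Sde (fun y t => proj y (drift X (phi y) t))
      (fun alpha y t => proj y (diffusion X alpha (phi y) t)).

(** * Brownian motion and iterated Ito integrals *)

(* The sigma-algebra generated by [W_u], [u \in D]. *)
Definition process_sigma (R : realType) (d : measure_display)
    (Omega : measurableType d) (m : nat) (W : 'I_m -> R -> Omega -> R)
    (D : set R) : set (set Omega) :=
  <<s [set A | exists alpha u (C : set R),
        [/\ D u, measurable C & A = W alpha u @^-1` C] ]>>.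

(* [m] independent standard Brownian motions: given the past, the increments
   over [s, t] are independent, with law N(0, t - s) each. *)
Definition is_brownian (R : realType) (d : measure_display)
    (Omega : measurableType d) (P : probability Omega R) (m : nat)
    (W : 'I_m -> R -> Omega -> R) : Prop :=
  [/\ forall alpha t, 0 <= t -> measurable_fun setT (W alpha t),
      forall alpha, {ae P, forall w, W alpha 0 w = 0},
      forall alpha, {ae P, forall w,
        {within `[0, +oo[%classic, continuous (fun t => W alpha t w)}}
    & forall (s t : R) (A : set Omega) (C : 'I_m -> set R),
        0 <= s -> s < t -> process_sigma W `[0, s]%classic A ->
        (forall alpha, measurable (C alpha)) ->
        P (A `&` [set w | forall alpha, C alpha (W alpha t w - W alpha s w)]) =
        (P A * \prod_(alpha < m) normal_prob 0 (Num.sqrt (t - s)) (C alpha))%E].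

Definition independent_processes (R : realType) (d : measure_display)
    (Omega : measurableType d) (P : probability Omega R) (m1 m2 : nat)
    (W1 : 'I_m1 -> R -> Omega -> R) (W2 : 'I_m2 -> R -> Omega -> R) : Prop :=
  forall A1 A2, process_sigma W1 `[0, +oo[%classic A1 ->
    process_sigma W2 `[0, +oo[%classic A2 -> P (A1 `&` A2) = (P A1 * P A2)%E.

(* [sum_(k < q) h k * 1_(tau k, tau k.+1]]; see [is_simple]. *)
Record simple_process (R : realType) (Omega : Type) := SimpleProcess {
  sp_size : nat;
  sp_time : nat -> R;
  sp_coef : nat -> Omega -> R
}.

Definition is_simple (R : realType) (d : measure_display)
    (Omega : measurableType d) (m : nat) (W : 'I_m -> R -> Omega -> R) (t : R)
    (H : simple_process R Omega) : Prop :=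
  [/\ sp_time H 0%N = 0, sp_time H (sp_size H) = t,
      forall k, (k < sp_size H)%N -> sp_time H k <= sp_time H k.+1,
      forall k, (k < sp_size H)%N -> exists c : R,
        forall w, `|sp_coef H k w| <= c
    & forall k (C : set R), (k < sp_size H)%N -> measurable C ->
        process_sigma W `[0, sp_time H k]%classic (sp_coef H k @^-1` C)].

Definition simple_val (R : realType) (Omega : Type)
    (H : simple_process R Omega) (s : R) (w : Omega) : R :=
  \sum_(k < sp_size H)
    sp_coef H k w * \1_(`]sp_time H k, sp_time H k.+1]%classic) s.

Definition simple_integral (R : realType) (Omega : Type)
    (H : simple_process R Omega) (B : R -> Omega -> R) (w : Omega) : R :=
  \sum_(k < sp_size H)
    sp_coef H k w * (B (sp_time H k.+1) w - B (sp_time H k) w).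

(* [Y] is a version of the Ito integral [\int_0^t G_s dW^alpha_s]. *)
Definition is_ito_integral (R : realType) (d : measure_display)
    (Omega : measurableType d) (P : probability Omega R) (m : nat)
    (W : 'I_m -> R -> Omega -> R) (alpha : 'I_m) (t : R)
    (G : R -> Omega -> R) (Y : Omega -> R) : Prop :=
  exists H : nat -> simple_process R Omega,
    [/\ forall p, is_simple W t (H p),
        (fun p => \int[lebesgue_measure]_(s in `[0%R, t]%classic)
           'E_P[fun w => ((simple_val (H p) s w - G s w) ^+ 2)%R])%E @ \oo --> 0%E
      & (fun p => 'E_P[fun w =>
           ((simple_integral (H p) (W alpha) w - Y w) ^+ 2)%R])%E @ \oo --> 0%E].

(* The entry [0] of a multi-index stands for time, the entry
   [lift ord0 alpha] for [W^alpha]. *)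
Definition multi_index (m : nat) := seq 'I_m.+1.

(* [I xi t] is a jointly measurable version of [I^xi_{0,t}(1)]. *)
Definition is_iterated_ito (R : realType) (d : measure_display)
    (Omega : measurableType d) (P : probability Omega R) (m : nat)
    (W : 'I_m -> R -> Omega -> R) (I : multi_index m -> R -> Omega -> R) :
    Prop :=
  [/\ forall xi, measurable_fun
        ((`[0%R, +oo[%classic : set (measurableTypeR R)) `*` [set: Omega])
        (fun z : measurableTypeR R * Omega => I xi z.1 z.2),
      forall t w, 0 <= t -> I [::] t w = 1,
      forall xi t, 0 <= t -> {ae P, forall w,
        I (rcons xi ord0) t w =
        \int[lebesgue_measure]_(s in `[0%R, t]%classic) I xi s w}
    & forall xi alpha t, 0 <= t ->
        is_ito_integral P W alpha t (I xi) (I (rcons xi (lift ord0 alpha)) t)].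

(** * Ito-Taylor expansions *)

Definition L_one (R : realType) (m N p : nat) (X : sde R m N)
    (j : 'I_m.+1) (f : 'rV[R]_N -> R -> 'rV[R]_p) (x : 'rV[R]_N) (t : R) :
    'rV[R]_p :=
  if unlift ord0 j is Some alpha then
    \sum_(i < N) diffusion X alpha x t 0 i *: partial i (f^~ t) x
  else
    'D_1 (f x) t + \sum_(i < N) drift X x t 0 i *: partial i (f^~ t) x
    + 2^-1 *: \sum_(alpha < m) \sum_(i < N) \sum_(j < N)
        (diffusion X alpha x t 0 i * diffusion X alpha x t 0 j) *:
          partial i (partial j (f^~ t)) x.

Definition L_multi (R : realType) (m N p : nat) (X : sde R m N)
    (xi : multi_index m) (f : 'rV[R]_N -> R -> 'rV[R]_p) :
    'rV[R]_N -> R -> 'rV[R]_p :=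
  foldr (fun j g => L_one X j g) f xi.

(* Expansion of order [k / 2] of [f (Z_t, t)], [Z] solving the Ito equation
   [X] with [Z_0 = z0]; [k] bounds [l(xi) + n(xi)], hence the length. *)
Definition ito_taylor (R : realType) (Omega : Type) (m N p : nat) (k : nat)
    (X : sde R m N) (f : 'rV[R]_N -> R -> 'rV[R]_p) (z0 : 'rV[R]_N)
    (I : multi_index m -> R -> Omega -> R) (t : R) (w : Omega) : 'rV[R]_p :=
  \sum_(l < k.+1)
    \sum_(xi : l.-tuple 'I_m.+1 | (size xi + count_mem ord0 xi <= k)%N)
      I xi t w *: L_multi X xi f z0 0.

(* Order [k / 2] expansion of [f (x_t) - F (y_t)] for Stratonovich equations
   [X], [Y] started at time 0 from [x0], [y0]. *)
Definition z_expansion (R : realType) (Omega : Type) (m r n p : nat) (k : nat)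
    (X : sde R m r) (Y : sde R m n) (f : 'rV[R]_r -> 'rV[R]_p)
    (F : 'rV[R]_n -> 'rV[R]_p) (x0 : 'rV[R]_r) (y0 : 'rV[R]_n)
    (I : multi_index m -> R -> Omega -> R) (t : R) (w : Omega) : 'rV[R]_p :=
  ito_taylor k (stack_sde (ito_of_strat X) (ito_of_strat Y))
    (fun z _ => f (lsubmx z) - F (rsubmx z)) (row_mx x0 y0) I t w.

(* [S_{k/2}(t)], for the initial condition [(x0, y0)] at time [t0]; [I] and
   [Ihat] are the iterated integrals of the forward Brownian motion and of
   the one driving the backward equations. *)
Definition S_half (R : realType) (d : measure_display)
    (Omega : measurableType d) (P : probability Omega R) (m r n p : nat)
    (I Ihat : multi_index m -> R -> Omega -> R)
    (f : 'rV[R]_r -> 'rV[R]_p) (F : 'rV[R]_n -> 'rV[R]_p)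
    (x0 : 'rV[R]_r) (y0 : 'rV[R]_n) (t0 : R) (k : nat)
    (X : sde R m r) (Y : sde R m n) (t : R) : \bar R :=
  let Xs := shift_sde t0 X in
  let Ys := shift_sde t0 Y in
  ((2^-1)%:E * 'E_P[fun w => sqnormv (z_expansion k Xs Ys f F x0 y0 I t w)]
   + (2^-1)%:E * 'E_P[fun w => sqnormv
       (z_expansion k (reverse_sde Xs) (reverse_sde Ys) f F x0 y0 Ihat t w)])%E.

(* Optimality of the Stratonovich projection for the maps [f], [F]: it is an
   equation on [psi @` U]; [S_{1/2}] is minimal at an initial condition if and
   only if the diffusion coefficients are there those of the projection; once
   they are so everywhere, [S_1] is minimal among the equations with the same
   diffusion coefficients if and only if so is the Stratonovich drift. *)
Definition strat_projection_optimal (R : realType) (d : measure_display)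
    (Omega : measurableType d) (P : probability Omega R) (m r n p : nat)
    (I Ihat : multi_index m -> R -> Omega -> R)
    (M U : set 'rV[R]_r) (psi : 'rV[R]_r -> 'rV[R]_n)
    (phi : 'rV[R]_n -> 'rV[R]_r) (J : set R) (X : sde R m r)
    (f : 'rV[R]_r -> 'rV[R]_p) (F : 'rV[R]_n -> 'rV[R]_p) : Prop :=
  let V := psi @` U in
  let S k Y x0 t0 t :=
    S_half P I Ihat f F x0 (psi x0) t0 k X Y t in
  let proj := strat_projection M psi phi X in
  [/\ admissible V J proj,
      forall (Y : sde R m n) (x0 : 'rV[R]_r) (t0 t : R),
        admissible V J Y -> U x0 -> J t0 -> 0 < t ->
        (forall Y' : sde R m n, admissible V J Y' ->
           (S 1%N Y x0 t0 t <= S 1%N Y' x0 t0 t)%E)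
        <->
        (forall alpha : 'I_m,
           diffusion Y alpha (psi x0) t0 = diffusion proj alpha (psi x0) t0)
    & forall (Y : sde R m n) (x0 : 'rV[R]_r) (t0 t : R),
        admissible V J Y ->
        (forall alpha y s, V y -> J s ->
           diffusion Y alpha y s = diffusion proj alpha y s) ->
        U x0 -> J t0 -> 0 < t ->
        (forall A' : 'rV[R]_n -> R -> 'rV[R]_n,
           (S 2%N Y x0 t0 t <= S 2%N (Sde A' (diffusion Y)) x0 t0 t)%E)
        <->
        drift Y (psi x0) t0 = drift proj (psi x0) t0].

(* Main.v *)
Require Import Defs.
From HB Require Import structures.
From mathcomp Require Import all_boot all_order all_algebra.
From mathcomp Require Import all_classical all_reals all_analysis.
From mathcomp Require Import measurable_realfun ring lra.

Import Order.TTheory GRing.Theory Num.Theory.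
Import numFieldNormedType.Exports.

Set Implicit Arguments.
Unset Strict Implicit.
Unset Printing Implicit Defensive.

Local Open Scope classical_set_scope.
Local Open Scope ring_scope.

(** The statement separates into a stochastic and a geometric part.

    Stochastic part.  Put [e_a := Df(x0) b_a - DF(y0) B_a] and
    [u := Df(x0) abar - DF(y0) Abar].  The order 1/2 expansion of
    [f (x_t) - F (y_t)] is [\sum_a e_a I^a_t], and [I^a_t] is the Brownian
    increment [W^a_t - W^a_0] by Ito's isometry, so [S_{1/2}(t)] is
    [t * \sum_a |e_a|^2] ([S_half1E]).  At order 1 the expansion is
    [t * (u + c)] plus square-integrable centred terms that do not involve the
    drift of [y] ([L_one_time], [expansion_noise_centered]); [c] is quadratic
    in the diffusion coefficients.  Reversing time changes the sign of [u] but
    not of [c], so by the parallelogram law [S_1(t)] is [t ^ 2 * |u|^2] plus a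
    constant ([S_half2E]).  Averaging over both directions of time is thus what
    makes the Stratonovich drift, and not the Ito drift, the minimizer.

    Geometric part.  What remains are the least-squares problems of minimizing
    [|Df(x0) v - DF(y0) w|^2] over [w], with [v = b_a] or [v = abar].  The
    projection [psi_* Pi v] solves them since the residual is orthogonal to the
    range of [DF(y0)], which is injective ([residual_optimal]).  For
    [F = phi] the range is the tangent space.  For [f = psi \o Pis] the
    residual is zero, because the differential of the metric projection at a
    point of [U] is the orthogonal projection onto the tangent space
    ([orth_proj_tangent]): differentiate the orthogonality of [x - Pis x] to
    the tangent space at [Pis x].  The same fact writes the projected
    coefficients as derivatives of [psi \o Pis], which shows that they are
    differentiable ([strat_projection_admissible]). *)

(** * Moments of the normal law *)

(** By uniqueness of the Radon-Nikodym derivative; [normal_prob] is defined on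
    sets only. *)
Lemma ge0_integral_normal_prob (R : realType) (s : R) (f : _ -> \bar R) :
  measurable_fun setT f -> (forall x, 0 <= f x)%E ->
  (\int[normal_prob 0 s]_x f x =
   \int[lebesgue_measure]_x (f x * (normal_pdf 0 s x)%:E))%E.
Proof.
move=> mf f0.
rewrite -(Radon_Nikodym_SigmaFinite.change_of_variables
            (normal_prob_dominates 0 s))//=.
apply: ae_eq_integral => //.
- apply: emeasurable_funM => //; apply: (measurable_int lebesgue_measure).
  exact: Radon_Nikodym_SigmaFinite.f_integrable (normal_prob_dominates 0 s).
- apply: emeasurable_funM => //; apply/measurable_EFinP.
  exact: measurable_normal_pdf.
- apply: ae_eqe_mul2l; apply: integral_ae_eq => //=.
  + exact: Radon_Nikodym_SigmaFinite.f_integrable (normal_prob_dominates 0 s).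
  + by apply/measurable_EFinP; exact: measurable_normal_pdf.
  + by move=> E _ mE; rewrite -Radon_Nikodym_SigmaFinite.f_integral//;
      exact: normal_prob_dominates.
Qed.

Lemma is_derive_normal_pdf (R : realType) (s : R) (x : R) : s != 0 ->
  is_derive x 1 (normal_pdf 0 s) (- (x / s ^+ 2) * normal_pdf 0 s x).
Proof.
move=> s0; rewrite !normal_pdfE// /normal_fun.
have D : is_derive x 1 (fun y : R => - (y - 0) ^+ 2 / (s ^+ 2 *+ 2)) (- (x / s ^+ 2)).
  under eq_fun do rewrite subr0 mulrC.
  apply: is_derive_eq.
  rewrite /GRing.scale /= !mulr1 -mulr_natr.
  by field.
apply: is_derive_eq.
by rewrite /GRing.scale /= mulrCA [in LHS]mulrC -!mulrA mulrCA.
Qed.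

(** With [y = x ^+ 2 / (2 * s ^+ 2)], one has [x * exp (- y) <= x / y]. *)
Lemma cvg_mul_normal_pdf (R : realType) (s : R) : 0 < s ->
  x * normal_pdf 0 s x @[x --> +oo] --> 0.
Proof.
move=> s0; have s_neq0 : s != 0 by rewrite gt_eqF.
apply: (@squeeze_cvgr _ _ _ _ (cst 0)
  (fun x => normal_peak s * (s ^+ 2 *+ 2) * x^-1)).
- near=> x.
  have x0 : 0 < x by near: x; exact: nbhs_pinfty_gt.
  apply/andP; split; first by rewrite mulr_ge0 ?normal_pdf_ge0 // ltW.
  rewrite normal_pdfE// /normal_fun subr0 mulrCA -[leRHS]mulrA ler_wpM2l ?normal_peak_ge0//.
  rewrite ler_pdivlMr// mulrAC -expr2 mulNr expRN.
  rewrite ler_pdivrMr ?expR_gt0// mulrC -ler_pdivrMr ?pmulrn_lgt0 ?exprn_gt0//.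
  by rewrite (le_trans _ (expR_ge1Dx _))// lerDr.
- exact: cvg_cst.
- rewrite -[X in _ --> X](mulr0 (normal_peak s * (s ^+ 2 *+ 2))).
  apply: cvgM; first exact: cvg_cst.
  by apply/(@gtr0_cvgV0 _ _ _ _ id); [exact: nbhs_pinfty_gt|exact: cvg_id].
Unshelve. all: by end_near.
Qed.

(** The function [- x * normal_pdf 0 s x] is a primitive of
    [((x / s) ^+ 2 - 1) * normal_pdf 0 s x], which is negative on [[0, s]] and
    positive beyond; its integrals over the two pieces cancel, so that
    [(x / s) ^+ 2] has the same mean as [1]. *)
Lemma integral_normal_pdf_second (R : realType) (s : R) : 0 < s ->
  (\int[lebesgue_measure]_x (x ^+ 2 * normal_pdf 0 s x)%:E = (s ^+ 2)%:E)%E.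
Proof.
move=> s0; have sN0 : s != 0 by rewrite gt_eqF.
pose g := normal_pdf 0 s; pose q x := (x / s) ^+ 2 * g x.
have g0 x : 0 <= g x by exact: normal_pdf_ge0.
have q0 x : 0 <= q x by rewrite mulr_ge0// sqr_ge0.
have cg : continuous g by exact: continuous_normal_pdf.
have cq : continuous q.
  move=> x; apply: cvgM; last exact: cg.
  apply: (cvg_comp (fun x => x / s) (fun x => x ^+ 2)); last exact: sqr_continuous.
  by apply: cvgM; [exact: cvg_id|exact: cvg_cst].
have mcont (f : R -> R) D : continuous f -> measurable_fun D (EFin \o f).
  move=> cf; apply/measurable_EFinP/measurable_funTS.
  exact: continuous_measurable_fun.
pose F (x : R) : R := - (x * g x).
have dF (x : R) : is_derive x 1 F (q x - g x).
  have ? := is_derive_normal_pdf x sN0; apply: is_derive_eq.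
  by rewrite /q /g /GRing.scale /= !mulr1; field.
have cF (x : R) : {for x, continuous F}.
  by apply: differentiable_continuous; apply/derivable1_diffP; case: (dF x).
have upper : (\int[lebesgue_measure]_(x in `[s, +oo[) (q x - g x)%:E =
    (s * g s)%:E)%E.
  rewrite (ge0_continuous_FTC2y (F := F) (l := 0))//.
  - by rewrite -EFinB sub0r opprK.
  - move=> x sx; rewrite subr_ge0 ler_peMl// exprn_ege1//.
    by rewrite ler_pdivlMr// mul1r.
  - by apply: continuous_subspaceT => x; apply: cvgB; [exact: cq|exact: cg].
  - rewrite /F -[X in _ --> X]oppr0; apply: cvgN; exact: cvg_mul_normal_pdf.
  - exact/cvg_at_right_filter/cF.
  - by move=> x _; rewrite derive1E derive_val.
have lower : (\int[lebesgue_measure]_(x in `[0%R, s]) (g x - q x)%:E =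
    (s * g s)%:E)%E.
  rewrite (continuous_FTC2 (F := fun x => - F x))//.
  - by rewrite -EFinB /F mul0r !opprK subr0.
  - by apply: continuous_subspaceT => x; apply: cvgB; [exact: cg|exact: cq].
  - split.
    + by move=> x _; apply: derivableN.
    + by apply/cvg_at_right_filter; apply: cvgN; exact/cF.
    + by apply/cvg_at_left_filter; apply: cvgN; exact/cF.
  - by move=> x _; rewrite derive1E derive_val opprB.
have split0s (f : R -> R) : continuous f -> (forall x, 0 <= f x) ->
    (\int[lebesgue_measure]_(x in [set x | (0 <= x)%R]) (f x)%:E =
     \int[lebesgue_measure]_(x in `[0%R, s]) (f x)%:E +
     \int[lebesgue_measure]_(x in `[s, +oo[) (f x)%:E)%E.
  move=> cf f0; rewrite -set_itvcy.
  have -> : `[0%R, +oo[%classic = `[0%R, s]%classic `|` `]s, +oo[%classic :> set R.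
    rewrite -(@itv_bndbnd_setU _ _ _ (BRight s))// bnd_simp; exact: ltW.
  rewrite ge0_integral_setU//=.
  - by rewrite integral_itv_obnd_cbnd//; exact: mcont.
  - exact: mcont.
  - by move=> x _; rewrite lee_fin.
  - apply/disj_setPS => x /= []; rewrite !in_itv/= => /andP[_ xs].
    by rewrite andbT ltNge xs.
have le1 (x : R) : 0 <= x -> (x <= s -> q x <= g x) /\ (s <= x -> g x <= q x).
  move=> x0; split => xs.
    by rewrite ler_piMl// exprn_ile1// ?divr_ge0// ?(ltW s0)// ler_pdivrMr// mul1r.
  by rewrite ler_peMl// exprn_ege1// ler_pdivlMr// mul1r.
have half : (\int[lebesgue_measure]_(x in [set x | (0 <= x)%R]) (q x)%:E =
    \int[lebesgue_measure]_(x in [set x | (0 <= x)%R]) (g x)%:E)%E.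
  rewrite !split0s//.
  have -> : (\int[lebesgue_measure]_(x in `[0%R, s]) (g x)%:E =
      \int[lebesgue_measure]_(x in `[0%R, s]) (q x)%:E + (s * g s)%:E)%E.
    rewrite -lower -ge0_integralD//=.
    - by apply: eq_integral => x _; rewrite -EFinD subrKC.
    - by move=> x _; rewrite lee_fin.
    - exact: mcont.
    - move=> x; rewrite in_itv/= => /andP[x0 xs].
      by rewrite lee_fin subr_ge0; apply: (le1 x x0).1.
    - by apply: mcont => x; apply: cvgB; [exact: cg|exact: cq].
  have -> : (\int[lebesgue_measure]_(x in `[s, +oo[) (q x)%:E =
      \int[lebesgue_measure]_(x in `[s, +oo[) (g x)%:E + (s * g s)%:E)%E.
    rewrite -upper -ge0_integralD//=.
    - by apply: eq_integral => x _; rewrite -EFinD subrKC.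
    - by move=> x _; rewrite lee_fin.
    - exact: mcont.
    - move=> x; rewrite in_itv/= andbT => xs.
      by rewrite lee_fin subr_ge0; apply: (le1 x (le_trans (ltW s0) xs)).2.
    - by apply: mcont => x; apply: cvgB; [exact: cq|exact: cg].
  by rewrite addeAC addeA.
have whole : (\int[lebesgue_measure]_x (q x)%:E = 1)%E.
  rewrite ge0_symfun_integralT//; last first.
    move=> x /=; rewrite /q /g mulNr sqrrN; congr (_ * _).
    by rewrite !normal_pdfE// /normal_fun !subr0 sqrrN.
  rewrite half -ge0_symfun_integralT//; first exact: integral_normal_pdf.
  by move=> x /=; rewrite /g !normal_pdfE// /normal_fun !subr0 sqrrN.
rewrite -[RHS]mule1 -whole -ge0_integralZl//=.
- by apply: eq_integral => x _; rewrite -EFinM /q -/(g x); congr EFin; field.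
- exact: mcont.
- by move=> x _; rewrite lee_fin.
- by rewrite lee_fin sqr_ge0.
Qed.

Lemma normal_prob_second_moment (R : realType) (s : R) : 0 < s ->
  (\int[normal_prob 0 s]_x (x ^+ 2)%:E = (s ^+ 2)%:E)%E.
Proof.
move=> s0; rewrite ge0_integral_normal_prob//=.
- by rewrite -integral_normal_pdf_second.
- by apply/measurable_EFinP; exact: measurable_funX.
- by move=> x; rewrite lee_fin sqr_ge0.
Qed.

Lemma normal_prob_integrable_id (R : realType) (s : R) : 0 < s ->
  (normal_prob 0 s).-integrable setT (fun x : R => x%:E).
Proof.
move=> s0; apply/integrableP; split; first exact/measurable_EFinP.
apply: (@le_lt_trans _ _ (\int[normal_prob 0 s]_x (1%:E + (x ^+ 2)%:E))%E).
  apply: ge0_le_integral => //=.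
  - by apply/measurable_EFinP; exact: normr_measurable.
  - by apply/measurable_EFinP; apply: measurable_funD => //; exact: measurable_funX.
  - move=> x _; rewrite -EFinD lee_fin -real_normK ?num_real//.
    have : 0 <= (`|x| - 2^-1) ^+ 2 by rewrite sqr_ge0.
    nra.
rewrite ge0_integralD//=.
- rewrite normal_prob_second_moment// integral_cst//= probability_setT mule1.
  by rewrite -EFinD ltry.
- by move=> x _; rewrite lee_fin sqr_ge0.
- by apply/measurable_EFinP; exact: measurable_funX.
Qed.

(** The density is even, so [|x|] integrates to twice the integral of its
    positive part, which leaves as much for the negative part. *)
Lemma normal_prob_mean (R : realType) (s : R) : 0 < s ->
  (\int[normal_prob 0 s]_x x%:E = 0)%E.
Proof.
move=> s0; have sN0 : s != 0 by rewrite gt_eqF.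
pose p (x : R) := Num.max x 0; pose n (x : R) := Num.max (- x) 0.
have mp : measurable_fun setT (EFin \o p : _ -> \bar R).
  by apply/measurable_EFinP; exact: measurable_maxr.
have mn : measurable_fun setT (EFin \o n : _ -> \bar R).
  by apply/measurable_EFinP; apply: measurable_maxr => //.
have p0 x : 0 <= p x by rewrite le_max lexx orbT.
have n0 x : 0 <= n x by rewrite le_max lexx orbT.
have pn x : `|x| = p x + n x.
  rewrite /p /n; have [x0|x0] := leP 0 x.
    by rewrite ger0_norm// max_r ?oppr_le0// addr0.
  by rewrite ltr0_norm// max_l ?oppr_ge0 ?(ltW x0)// add0r.
have pEn x : x = p x - n x.
  rewrite /p /n; have [x0|x0] := leP 0 x.
    by rewrite max_r ?oppr_le0// subr0.
  by rewrite max_l ?oppr_ge0 ?(ltW x0)// sub0r opprK.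
pose I (f : R -> R) : \bar R := (\int[normal_prob 0 s]_x (f x)%:E)%E.
have Ipn : (I (fun x => `|x|%R) = I p + I n)%E.
  rewrite -ge0_integralD//=; last 2 first.
  - by move=> x _; rewrite lee_fin.
  - by move=> x _; rewrite lee_fin.
  by apply: eq_integral => x _; rewrite pn EFinD.
have I2p : (I (fun x => `|x|%R) = I p + I p)%E.
  rewrite /I ge0_integral_normal_prob//=; last first.
    by apply/measurable_EFinP; exact: normr_measurable.
  rewrite (_ : (\int[_]_x _)%E =
    (\int[lebesgue_measure]_x (`|x|%R * normal_pdf 0 s x)%:E)%E)//.
  rewrite ge0_symfun_integralT//.
  - rewrite -mule2n -mule_natl; congr (_ * _)%E.
    rewrite ge0_integral_normal_prob//=.
    rewrite integral_mkcond; apply: eq_integral => x _.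
    rewrite patchE; case: ifPn; rewrite ?inE ?notin_setE /= => x0.
      by rewrite -EFinM /p max_l// ger0_norm.
    by rewrite /p max_r ?mul0e// leNgt; apply/negP => /ltW.
  - by move=> x; rewrite mulr_ge0// normal_pdf_ge0.
  - move=> x; apply: cvgM; first exact: norm_continuous.
    exact: continuous_normal_pdf.
  - by move=> x /=; rewrite normrN !normal_pdfE// /normal_fun !subr0 sqrrN.
have fin : I (fun x => `|x|%R) \is a fin_num.
  have /integrable_abse/integrable_fin_num := normal_prob_integrable_id s0.
  exact.
have /andP[finp finn] : (I p \is a fin_num) && (I n \is a fin_num).
  by rewrite -fin_numD -Ipn.
rewrite (_ : (\int[_]_x _)%E = I (fun x => p x - n x)); last first.
  by apply: eq_integral => x _; rewrite -pEn.
have ip : (normal_prob 0 s).-integrable setT (EFin \o p).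
  apply/integrableP; split => //.
  rewrite -[X in (X < _)%E]/(\int[normal_prob 0 s]_x `|(p x)%:E|)%E.
  under eq_integral do rewrite gee0_abs ?lee_fin//.
  by rewrite -ge0_fin_numE// integral_ge0// => x _; rewrite lee_fin.
have in_ : (normal_prob 0 s).-integrable setT (EFin \o n).
  apply/integrableP; split => //.
  under eq_integral do rewrite [(EFin \o n) _]/= gee0_abs ?lee_fin//.
  by rewrite -ge0_fin_numE// integral_ge0// => x _; rewrite lee_fin.
rewrite {1}/I; under eq_integral do rewrite EFinB.
rewrite integralB//= -/(I p) -/(I n).
have [[a Ia] [b Ib]] := (EFin_fin_numP _ finp, EFin_fin_numP _ finn).
move: I2p; rewrite Ipn Ia Ib -!EFinD => -[] /addrI ba.
by rewrite ba subrr.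
Qed.

(** * Independence and square-integrable variables *)

(** The joint law of [Z] and [D] is a product measure, to which Fubini's theorem
    applies. *)
Lemma independent_integral d (T : measurableType d) (R : realType)
    (P : probability T R) (nu : probability (measurableTypeR R) R)
    (Z D : T -> R) (g : R -> R) :
  measurable_fun setT D ->
  (forall A C, measurable A -> measurable C ->
     P (Z @^-1` A `&` D @^-1` C) = (P (Z @^-1` A) * nu C)%E) ->
  P.-integrable setT (EFin \o Z) -> nu.-integrable setT (EFin \o g) ->
  P.-integrable setT (fun w => (Z w * g (D w))%:E) /\
  (\int[P]_w (Z w * g (D w))%:E =
   \int[P]_w (Z w)%:E * \int[nu]_x (g x)%:E)%E.
Proof.
move=> mD ZD iZ ig.
have mZ : measurable_fun setT Z.
  by apply/measurable_EFinP; exact: measurable_int iZ.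
have mg : measurable_fun setT g.
  by apply/measurable_EFinP; exact: measurable_int ig.
pose Z' : {mfun T >-> measurableTypeR R} :=
  @mfun_Sub _ _ T (measurableTypeR R) Z (mem_set mZ).
pose W' : {mfun T >-> (measurableTypeR R * measurableTypeR R)%type} :=
  @mfun_Sub _ _ T (measurableTypeR R * measurableTypeR R)%type _
    (mem_set (measurable_fun_pair mZ mD)).
pose Q := distribution P Z'; pose J := distribution P W'.
have JE A : measurable A -> (Q \x nu)%E A = J A.
  by apply: product_measure_unique => A1 A2 mA1 mA2; rewrite /J /Q -ZD.
pose h (z : R * R) : \bar R := (z.1 * g z.2)%:E.
have mh : measurable_fun setT (h : (measurableTypeR R * measurableTypeR R)%type -> _).
  apply/measurable_EFinP; apply: measurable_funM => //.
  exact: measurableT_comp.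
have iZ' : Q.-integrable setT (EFin : measurableTypeR R -> _).
  by apply: integrable_pushforward.
have iQ : (Q \x nu)%E.-integrable setT h.
  apply/integrable12ltyP => //.
  under eq_integral => x _.
    rewrite (_ : (\int[nu]_y _)%E = (`|x|%:E * \int[nu]_y `|(g y)%:E|)%E); last first.
      rewrite -ge0_integralZl//=.
      - by apply: eq_integral => y _; rewrite normrM EFinM.
      - by apply/measurable_EFinP; exact: measurableT_comp.
    over.
  move/integrableP : ig => [_ ig]; move/integrableP : iZ' => [_ iZ'].
  rewrite ge0_integralZr//=.
  - rewrite lte_mul_pinfty//; first exact: integral_ge0.
    by rewrite ge0_fin_numE//; exact: integral_ge0.
  - by apply/measurable_EFinP; exact: normr_measurable.
  - exact: integral_ge0.
have mW : measurable_fun setT (fun w => (Z w, D w)).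
  exact: measurable_fun_pair.
have iP : P.-integrable setT (fun w => (Z w * g (D w))%:E).
  apply/integrableP; split.
    apply/measurable_EFinP; apply: measurable_funM => //.
    exact: measurableT_comp.
  move/integrableP : iQ => [_]; rewrite (eq_measure_integral J); last first.
    by move=> A mA _; exact: JE.
  rewrite ge0_integral_pushforward//.
  by apply: measurableT_comp.
split=> //; transitivity (\int[J]_z h z)%E.
  by rewrite integral_pushforward.
rewrite -(eq_measure_integral J (m1 := (Q \x nu)%E)); last first.
  by move=> A mA _; exact: JE.
rewrite -integral12_prod_meas1//.
have [_ igy] := integrableP _ _ _ ig.
transitivity (\int[Q]_x (x%:E * \int[nu]_y (g y)%:E))%E.
  apply: eq_integral => x _; rewrite -integralZl//.
have finG : (\int[nu]_y (g y)%:E \is a fin_num)%E by exact: integrable_fin_num.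
rewrite -(fineK finG) integralZr//; congr (_ * _)%E.
by rewrite integral_pushforward.
Qed.

(** Real-valued, so that the bilinear algebra of square-integrable variables
    takes place in [R]; meaningful on [Lfun P 1], see [meanE]. *)
Definition mean d (T : measurableType d) (R : realType) (P : probability T R)
  (X : T -> R) : R := fine ('E_P[X])%E.

Section square_integrable.
Context d (T : measurableType d) (R : realType) (P : probability T R).
Implicit Types X Y : T -> R.

Local Notation L1 := (Lfun P 1).
Local Notation L2 := (Lfun P 2%:E).

Lemma Lfun_measurable p X : X \in Lfun P p -> measurable_fun setT X.
Proof. by rewrite inE => /andP[/[!inE]]. Qed.

Lemma Lfun2_Lfun1 X : X \in L2 -> X \in L1.
Proof. by apply: Lfun_subset12; rewrite fin_num_measure. Qed.

Lemma Lfun2_sqr_lty X : measurable_fun setT X ->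
  ('E_P[fun w => (X w ^+ 2)%R] < +oo)%E -> X \in L2.
Proof.
move=> mX; rewrite unlock => fX.
rewrite inE/=; apply/andP; split; rewrite inE//=.
rewrite /finite_norm unlock poweR_lty//.
apply: le_lt_trans fX; rewrite le_eqVlt; apply/orP; left; apply/eqP.
by apply: eq_integral => x _ /=; rewrite powR_mulrn// real_normK// num_real.
Qed.

Lemma Lfun2_bounded X (c : R) : measurable_fun setT X -> (forall w, `|X w| <= c) ->
  X \in L2.
Proof.
move=> mX Xc; apply: Lfun2_sqr_lty => //.
suff : ('E_P[fun w => (X w ^+ 2)%R] <= 'E_P[cst (c ^+ 2)%R])%E.
  by move=> /le_lt_trans; apply; rewrite expectation_cst ltry.
apply: expectation_le => //.
- exact: measurable_funX.
- by move=> w; rewrite sqr_ge0.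
- by move=> w; rewrite sqr_ge0.
- apply/nearW => w; rewrite -real_normK ?num_real//.
  by rewrite lerXn2r ?nnegrE// (le_trans _ (Xc w)).
Qed.

Lemma Lfun2D X Y : X \in L2 -> Y \in L2 -> (fun w => X w + Y w) \in L2.
Proof. by move=> X2 Y2; apply: (rpredD X2 Y2); rewrite lee1n. Qed.

Lemma Lfun2Z a X : X \in L2 -> (fun w => a * X w) \in L2.
Proof.
move=> X2; rewrite (_ : (fun _ => _) = a \o* X); last first.
  by apply/funext => w /=; rewrite mulrC.
by apply: Lfun_scale => //; rewrite ler1n.
Qed.

Lemma Lfun2B X Y : X \in L2 -> Y \in L2 -> (fun w => X w - Y w) \in L2.
Proof.
move=> X2 Y2; rewrite (_ : (fun _ => _) = (fun w => X w + -1 * Y w)).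
  by apply: Lfun2D => //; exact: Lfun2Z.
by apply/funext => w; rewrite mulN1r.
Qed.

Lemma Lfun2_sum (I : Type) (r : seq I) (Q : pred I) (X : I -> T -> R) :
  (forall i, Q i -> X i \in L2) -> (fun w => \sum_(i <- r | Q i) X i w) \in L2.
Proof.
move=> X2; elim: r => [|i r IH].
  rewrite (_ : (fun _ => _) = cst 0); first exact: Lfun_cst.
  by apply/funext => w; rewrite big_nil.
under eq_fun do rewrite big_cons.
by case: (boolP (Q i)) => // /X2 Xi; exact: Lfun2D.
Qed.

Lemma Lfun1D X Y : X \in L1 -> Y \in L1 -> (fun w => X w + Y w) \in L1.
Proof. by move=> X1 Y1; apply: (rpredD X1 Y1). Qed.

Lemma Lfun1Z a X : X \in L1 -> (fun w => a * X w) \in L1.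
Proof.
move=> X1; rewrite (_ : (fun _ => _) = a \o* X); last first.
  by apply/funext => w /=; rewrite mulrC.
exact: Lfun_scale.
Qed.

Lemma Lfun1_sum (I : Type) (r : seq I) (Q : pred I) (X : I -> T -> R) :
  (forall i, Q i -> X i \in L1) -> (fun w => \sum_(i <- r | Q i) X i w) \in L1.
Proof.
move=> X1; elim: r => [|i r IH].
  rewrite (_ : (fun _ => _) = cst 0); first exact: Lfun_cst.
  by apply/funext => w; rewrite big_nil.
under eq_fun do rewrite big_cons.
by case: (boolP (Q i)) => // /X1 Xi; exact: Lfun1D.
Qed.

Lemma meanE X : X \in L1 -> 'E_P[X]%E = (mean P X)%:E.
Proof. by move=> X1; rewrite fineK// expectation_fin_num. Qed.

Lemma meanD X Y : X \in L1 -> Y \in L1 ->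
  mean P (fun w => X w + Y w) = mean P X + mean P Y.
Proof.
move=> X1 Y1; apply: EFin_inj; rewrite EFinD -!meanE//; first exact: expectationD.
exact: Lfun1D.
Qed.

Lemma meanZ a X : X \in L1 -> mean P (fun w => a * X w) = a * mean P X.
Proof.
move=> X1; apply: EFin_inj; rewrite EFinM -!meanE//; last exact: Lfun1Z.
rewrite -expectationZl//; congr ('E_P[_])%E.
by apply/funext => w /=; rewrite mulrC.
Qed.

Lemma mean_cst a : mean P (cst a) = a.
Proof. by rewrite /mean expectation_cst. Qed.

Lemma mean_sum (I : Type) (r : seq I) (Q : pred I) (X : I -> T -> R) :
  (forall i, Q i -> X i \in L1) ->
  mean P (fun w => \sum_(i <- r | Q i) X i w) = \sum_(i <- r | Q i) mean P (X i).
Proof.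
move=> X1; elim: r => [|i r IH].
  rewrite big_nil -[RHS]mean_cst; congr mean.
  by apply/funext => w; rewrite big_nil.
under eq_fun do rewrite big_cons.
rewrite big_cons -IH; case: (boolP (Q i)) => // /X1 Xi; rewrite meanD//.
exact: Lfun1_sum.
Qed.

Lemma mean_ge0 X : (forall w, 0 <= X w) -> 0 <= mean P X.
Proof. by move=> X0; rewrite fine_ge0// expectation_ge0. Qed.

Lemma Lfun2M X Y : X \in L2 -> Y \in L2 -> (fun w => X w * Y w) \in L1.
Proof. exact: Lfun2_mul_Lfun1. Qed.

Lemma Lfun2_sqr X : X \in L2 -> (fun w => X w ^+ 2) \in L1.
Proof. by move=> X2; apply/Lfun1_integrable; exact: Lfun2_integrable_sqr. Qed.

Lemma mean_sqrD X Y : X \in L2 -> Y \in L2 ->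
  mean P (fun w => (X w + Y w) ^+ 2) =
  mean P (fun w => X w ^+ 2) + 2 * mean P (fun w => X w * Y w) +
  mean P (fun w => Y w ^+ 2).
Proof.
move=> X2 Y2; rewrite -meanZ ?Lfun2M// -!meanD ?Lfun1D ?Lfun1Z ?Lfun2M ?Lfun2_sqr//.
by congr mean; apply/funext => w; rewrite sqrrD mulr_natl.
Qed.

Lemma mean_sqr_cst_add a X : X \in L2 -> mean P X = 0 ->
  mean P (fun w => (a + X w) ^+ 2) = a ^+ 2 + mean P (fun w => X w ^+ 2).
Proof.
move=> X2 EX; rewrite (mean_sqrD (X := cst a))//; last exact: Lfun_cst.
rewrite (meanZ a (Lfun2_Lfun1 X2)).
by rewrite EX !mulr0 addr0 (mean_cst (a ^+ 2)).
Qed.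

(** The variance is nonnegative. *)
Lemma mean_sqr_le X : X \in L2 -> mean P X ^+ 2 <= mean P (fun w => X w ^+ 2).
Proof.
move=> X2; set a := mean P X.
have : 0 <= mean P (fun w => (- a + X w) ^+ 2).
  by apply: mean_ge0 => w; rewrite sqr_ge0.
rewrite (mean_sqrD (X := cst (- a)))//; last exact: Lfun_cst.
rewrite (meanZ (- a) (Lfun2_Lfun1 X2)) (mean_cst ((- a) ^+ 2)) -/a.
nra.
Qed.

End square_integrable.

(** * Brownian increments and the past *)

Section adapted.
Context d (T : measurableType d) (R : realType) (m : nat).
Implicit Types (W : 'I_m -> R -> T -> R) (D : set R) (Z : T -> R).

Definition adapted W D Z :=
  forall C : set R, measurable C -> process_sigma W D (Z @^-1` C).

(** Naming the generators of [process_sigma W D] gives access to the measurable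
    type [g_sigma_algebraType], and to the closure properties of measurable
    functions on it. *)
Definition process_generator W D : set (set T) :=
  [set A | exists alpha u (C : set R),
     [/\ D u, measurable C & A = W alpha u @^-1` C]].

Lemma adaptedP W D Z : adapted W D Z <->
  measurable_fun setT (Z : g_sigma_algebraType (process_generator W D) -> R).
Proof.
split=> [aZ _ C mC|mZ C mC]; first by rewrite setTI; exact: aZ.
by rewrite -[_ @^-1` _]setTI; exact: mZ.
Qed.

Lemma adaptedM W D Z1 Z2 : adapted W D Z1 -> adapted W D Z2 ->
  adapted W D (fun w => Z1 w * Z2 w).
Proof.
by move=> /adaptedP ? /adaptedP ?; apply/adaptedP; exact: measurable_funM.
Qed.

Lemma adaptedD W D Z1 Z2 : adapted W D Z1 -> adapted W D Z2 ->
  adapted W D (fun w => Z1 w + Z2 w).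
Proof.
by move=> /adaptedP ? /adaptedP ?; apply/adaptedP; exact: measurable_funD.
Qed.

Lemma adaptedB W D Z1 Z2 : adapted W D Z1 -> adapted W D Z2 ->
  adapted W D (fun w => Z1 w - Z2 w).
Proof.
by move=> /adaptedP ? /adaptedP ?; apply/adaptedP; exact: measurable_funB.
Qed.

Lemma adapted_cst W D (a : R) : adapted W D (cst a).
Proof. by apply/adaptedP. Qed.

Lemma adapted_process W D alpha u : D u -> adapted W D (W alpha u).
Proof.
move=> Du C mC; apply: sub_sigma_algebra.
by exists alpha, u, C.
Qed.

Lemma adapted_sub W D D' Z : D `<=` D' -> adapted W D Z -> adapted W D' Z.
Proof.
move=> DD' aZ C /aZ; apply: sub_sigma_algebra2.
move=> A [alpha [u [C' [Du mC' ->]]]].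
by exists alpha, u, C'; split => //; exact: DD'.
Qed.

Lemma adapted_measurable W D Z : D `<=` `[0, +oo[%classic ->
  (forall alpha t, 0 <= t -> measurable_fun setT (W alpha t)) ->
  adapted W D Z -> measurable_fun setT Z.
Proof.
move=> D0 mW aZ _ C mC; rewrite setTI.
have := aZ _ mC; apply: smallest_sub; first exact: sigma_algebra_measurable.
move=> A [alpha [u [C' [Du mC' ->]]]].
rewrite -[_ @^-1` _]setTI; apply: mW => //.
by have := D0 _ Du; rewrite /= in_itv/= andbT.
Qed.

End adapted.

Section increments.
Context (R : realType) d (T : measurableType d) (P : probability T R) (m : nat).
Variable W : 'I_m -> R -> T -> R.
Hypothesis HW : is_brownian P W.

Local Notation L1 := (Lfun P 1).
Local Notation L2 := (Lfun P 2%:E).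

Definition increment (alpha : 'I_m) (s t : R) (w : T) : R :=
  W alpha t w - W alpha s w.

Lemma brownian_measurable alpha t : 0 <= t -> measurable_fun setT (W alpha t).
Proof. by case: HW => mW _ _ _; exact: mW. Qed.

Lemma increment_measurable alpha s t : 0 <= s -> s <= t ->
  measurable_fun setT (increment alpha s t).
Proof.
move=> s0 st; apply: measurable_funB; apply: brownian_measurable => //.
exact: le_trans st.
Qed.

Lemma past_measurable s Z : adapted W `[0, s]%classic Z ->
  measurable_fun setT Z.
Proof.
apply: adapted_measurable; last exact: brownian_measurable.
by move=> u /=; rewrite !in_itv/= andbT => /andP[].
Qed.

Lemma increment_independent alpha s t Z (A C : set R) : 0 <= s -> s < t ->
  adapted W `[0, s]%classic Z -> measurable A -> measurable C ->
  P (Z @^-1` A `&` increment alpha s t @^-1` C) =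
  (P (Z @^-1` A) * normal_prob 0 (Num.sqrt (t - s)) C)%E.
Proof.
move=> s0 st aZ mA mC; case: HW => _ _ _ ind.
have := ind s t (Z @^-1` A) (fun b => if b == alpha then C else setT) s0 st
  (aZ _ mA).
rewrite (bigD1 alpha)//= eqxx big1 ?mule1; last first.
  by move=> b /negbTE ->; rewrite probability_setT.
move=> <-; last by move=> b; case: ifP.
congr (P (_ `&` _)); apply/seteqP; split => w /=.
  by move=> wC b; case: eqP => // ->.
by move=> /(_ alpha); rewrite eqxx.
Qed.

(** Here [s = 0] and the past event is trivial; the two components are
    constrained at once and the others left free. *)
Lemma increments_independent alpha beta t (A C : set R) : 0 < t ->
  alpha != beta -> measurable A -> measurable C ->
  P (increment alpha 0 t @^-1` A `&` increment beta 0 t @^-1` C) =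
  (P (increment alpha 0 t @^-1` A) * normal_prob 0 (Num.sqrt t) C)%E.
Proof.
move=> t0 ab mA mC; have ba : beta != alpha by rewrite eq_sym.
case: HW => _ _ _ ind.
have pT : process_sigma W `[0, 0]%classic [set: T].
  exact: (@measurableT _ (g_sigma_algebraType (process_generator W `[0, 0]%classic))).
have h C' := ind 0 t setT (fun b => if b == alpha then A else
  if b == beta then C' else setT) (lexx 0) t0 pT.
have mC' C' : measurable C' -> forall b,
    measurable (if b == alpha then A else if b == beta then C' else setT).
  by move=> ? b; case: ifP => // _; case: ifP.
have E C' : measurable C' ->
    P (increment alpha 0 t @^-1` A `&` increment beta 0 t @^-1` C') =
    (normal_prob 0 (Num.sqrt t) A * normal_prob 0 (Num.sqrt t) C')%E.
  move=> mC0; have := h _ (mC' _ mC0).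
  rewrite (bigD1 alpha)//= eqxx (bigD1 beta)//= (negbTE ba) eqxx.
  rewrite [X in (_ * (_ * (_ * X)))%E]big1; last first.
    by move=> b /andP[/negbTE -> /negbTE ->]; rewrite probability_setT.
  rewrite (subr0 t); move: (normal_prob 0 _ A) (normal_prob 0 _ C') => a c.
  rewrite probability_setT mul1e mule1 => <-; rewrite setTI; congr (P _).
  apply/seteqP; split => w /=.
    by move=> [wA wC] b; case: eqP => [->//|_]; case: eqP => [->//|].
  move=> wb; split; first by have := wb alpha; rewrite eqxx.
  by have := wb beta; rewrite (negbTE ba) eqxx.
rewrite E//; congr (_ * _)%E.
have := E setT measurableT; rewrite preimage_setT setIT => ->.
by rewrite [X in (_ * X)%E]probability_setT mule1.
Qed.

End increments.

(** * Ito integrals *)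

Section isometry.
Context (R : realType) d (T : measurableType d) (P : probability T R) (m : nat).
Variable W : 'I_m -> R -> T -> R.
Hypothesis HW : is_brownian P W.

Local Notation L1 := (Lfun P 1).
Local Notation L2 := (Lfun P 2%:E).
Local Notation increment := (increment W).

Lemma increment_refl alpha (s : R) w : increment alpha s s w = 0.
Proof. exact: subrr. Qed.

(** The increment is independent of the past variable [Z], centred, and has
    variance [t - s]. *)
Lemma increment_moments alpha (s t : R) Z : 0 <= s -> s <= t ->
  adapted W `[0, s]%classic Z -> Z \in L1 ->
  [/\ (fun w => Z w * increment alpha s t w) \in L1,
      mean P (fun w => Z w * increment alpha s t w) = 0,
      (fun w => Z w * increment alpha s t w ^+ 2) \in L1
    & mean P (fun w => Z w * increment alpha s t w ^+ 2) = mean P Z * (t - s)].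
Proof.
move=> s0; rewrite le_eqVlt => /predU1P[<- aZ Z1|st aZ Z1].
  have c0 : cst 0 \in L1 by exact: Lfun_cst.
  have -> : (fun w => Z w * increment alpha s s w) = cst 0.
    by apply/funext => w; rewrite increment_refl mulr0.
  have -> : (fun w => Z w * increment alpha s s w ^+ 2) = cst 0.
    by apply/funext => w; rewrite increment_refl expr0n mulr0.
  by rewrite (mean_cst P 0) subrr mulr0.
have r0 : 0 < Num.sqrt (t - s) by rewrite sqrtr_gt0 subr_gt0.
pose nu : probability (measurableTypeR R) R := normal_prob 0 (Num.sqrt (t - s)).
have mI : measurable_fun setT (increment alpha s t).
  by apply: (increment_measurable HW) => //; exact: ltW.
have ind A C : measurable A -> measurable C ->
    P (Z @^-1` A `&` increment alpha s t @^-1` C) = (P (Z @^-1` A) * nu C)%E.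
  by move=> mA mC; exact: increment_independent HW _ _ _ _ _ _ _ _ _ _ _.
have iZ : P.-integrable setT (EFin \o Z) by exact/Lfun1_integrable.
have [i1 E1] := independent_integral mI ind iZ (normal_prob_integrable_id r0).
have i2' : nu.-integrable setT (EFin \o (fun x : R => x ^+ 2)).
  apply/integrableP; split; first by apply/measurable_EFinP; exact: measurable_funX.
  under eq_integral do rewrite gee0_abs ?lee_fin ?sqr_ge0//.
  by rewrite normal_prob_second_moment// ltry.
have [i2 E2] := independent_integral mI ind iZ i2'.
split.
- exact/Lfun1_integrable.
- by rewrite /mean unlock E1 normal_prob_mean// mule0.
- exact/Lfun1_integrable.
- rewrite /mean [in LHS]unlock E2 normal_prob_second_moment// sqr_sqrtr ?subr_ge0 ?ltW//.
  by rewrite fineM//; [rewrite unlock|exact: integrable_fin_num].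
Qed.

Lemma increment_Lfun2 alpha (s t : R) : 0 <= s -> s <= t -> increment alpha s t \in L2.
Proof.
move=> s0 st; apply: Lfun2_sqr_lty; first exact: (increment_measurable HW).
have c1 : cst 1 \in L1 by exact: Lfun_cst.
have [_ _ i2 _] := increment_moments alpha s0 st
  (@adapted_cst _ _ _ _ W `[0, s]%classic 1) c1.
by move: i2; under eq_fun do rewrite mul1r; move=> i2; rewrite meanE// ltry.
Qed.

Lemma bounded_mul_Lfun2 (Z1 Z2 : T -> R) (c : R) : measurable_fun setT Z1 ->
  (forall w, `|Z1 w| <= c) -> Z2 \in L2 -> (fun w => Z1 w * Z2 w) \in L2.
Proof.
move=> mZ1 Z1c Z2L.
have mZ2 := Lfun_measurable Z2L.
have c2Z := Lfun2Z c Z2L.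
apply: Lfun2_sqr_lty; first exact: measurable_funM.
suff : ('E_P[fun w => ((Z1 w * Z2 w) ^+ 2)%R] <= 'E_P[fun w => ((c * Z2 w) ^+ 2)%R])%E.
  by move=> /le_lt_trans; apply; rewrite meanE ?ltry// Lfun2_sqr.
apply: expectation_le => //.
- by apply: measurable_funX; exact: measurable_funM.
- by apply: measurable_funX; exact: measurable_funM.
- by move=> w; rewrite sqr_ge0.
- by move=> w; rewrite sqr_ge0.
- apply/nearW => w; rewrite !exprMn ler_wpM2r ?sqr_ge0//.
  by rewrite -(real_normK (num_real (Z1 w))) lerXn2r ?nnegrE// (le_trans _ (Z1c w)).
Qed.

(** Ito isometry for step integrands.  The sum of the first [n] terms is
    adapted to the past of [tau n], so that the increment of the next term is
    independent of it and centred: the cross terms vanish. *)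
Lemma step_integral_isometry alpha (n : nat) (tau : nat -> R) (k : nat -> T -> R) :
  0 <= tau 0%N ->
  (forall i, (i < n)%N -> tau i <= tau i.+1) ->
  (forall i, (i < n)%N -> exists c : R, forall w, `|k i w| <= c) ->
  (forall i, (i < n)%N -> adapted W `[0, tau i]%classic (k i)) ->
  let S w := \sum_(i < n) k i w * increment alpha (tau i) (tau i.+1) w in
  [/\ 0 <= tau n, adapted W `[0, tau n]%classic S, S \in L2, mean P S = 0
    & mean P (fun w => S w ^+ 2) =
      \sum_(i < n) mean P (fun w => k i w ^+ 2) * (tau i.+1 - tau i)].
Proof.
move=> tau0; elim: n => [|n IH] mono kb ka /=.
  have -> : (fun w => \sum_(i < 0) k i w * increment alpha (tau i) (tau i.+1) w) = cst 0.
    by apply/funext => w; rewrite big_ord0.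
  split => //; [exact: adapted_cst|exact: Lfun_cst|exact: mean_cst|].
  rewrite big_ord0 -[RHS](mean_cst P 0); congr mean.
  by apply/funext => w; rewrite big_ord0 expr0n.
have [||| taun aS S2 ES ESS] := IH.
- by move=> i ni; apply: mono; exact: ltnW.
- by move=> i ni; apply: kb; exact: ltnW.
- by move=> i ni; apply: ka; exact: ltnW.
pose S w := \sum_(i < n) k i w * increment alpha (tau i) (tau i.+1) w.
have {}aS : adapted W `[0, tau n]%classic S := aS.
have {}S2 : S \in L2 := S2.
have {}ES : mean P S = 0 := ES.
rewrite -[X in X = _]/(mean P (fun w => S w ^+ 2)) in ESS.
set t := tau n in taun aS *; set t' := tau n.+1.
have tt' : t <= t' by exact: mono.
have [c knc] := kb n (ltnSn n); have kna := ka n (ltnSn n); rewrite -/t in kna.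
have mk := past_measurable HW kna.
have k2 : k n \in L2 by exact: Lfun2_bounded knc.
have I2 := increment_Lfun2 alpha taun tt'.
pose I w := k n w * increment alpha t t' w.
have IL2 : I \in L2 by exact: bounded_mul_Lfun2 mk knc I2.
have SI w : \sum_(i < n.+1) k i w * increment alpha (tau i) (tau i.+1) w = S w + I w.
  by rewrite big_ord_recr.
have [_ EI _ _] := increment_moments alpha taun tt' kna (Lfun2_Lfun1 k2).
have cross : mean P (fun w => S w * I w) = 0.
  have [_ <- _ _] := increment_moments alpha taun tt' (adaptedM aS kna) (Lfun2M S2 k2).
  by congr mean; apply/funext => w; rewrite mulrA.
have EII : mean P (fun w => I w ^+ 2) = mean P (fun w => k n w ^+ 2) * (t' - t).
  have [_ _ _ <-] := increment_moments alpha taun tt' (adaptedM kna kna) (Lfun2M k2 k2).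
  by congr mean; apply/funext => w; rewrite /I exprMn expr2.
have mem (u : R) : 0 <= u -> u <= t' -> `[0, t']%classic u.
  by move=> ? ?; rewrite /= in_itv/=; apply/andP.
have sub : `[0, t]%classic `<=` `[0, t']%classic.
  by move=> u /=; rewrite in_itv/= => /andP[u0 ut]; apply: mem => //; exact: le_trans tt'.
rewrite (_ : (fun w => \sum_(i < n.+1) _) = (fun w => S w + I w)); last exact/funext.
split.
- exact: le_trans tt'.
- apply: adaptedD; first exact: adapted_sub aS.
  apply: adaptedM; first exact: adapted_sub kna.
  by apply: adaptedB; apply: adapted_process; apply: mem => //; exact: le_trans tt'.
- exact: Lfun2D.
- by rewrite meanD ?Lfun2_Lfun1// ES EI addr0.
- rewrite big_ord_recr/=; under eq_fun do rewrite SI.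
  by rewrite mean_sqrD// cross mulr0 addr0 ESS EII.
Qed.

End isometry.

Section step_functions.
Variables (R : realType) (n : nat) (tau : nat -> R).
Hypothesis mono : forall k, (k < n)%N -> tau k <= tau k.+1.

Lemma step_mono i j : (i <= j)%N -> (j <= n)%N -> tau i <= tau j.
Proof.
elim: j => [|j IH]; first by rewrite leqn0 => /eqP ->.
rewrite leq_eqVlt => /predU1P[-> //|ij jn].
exact: le_trans (IH ij (ltnW jn)) (mono jn).
Qed.

(** The first time [tau j] that is not before [s] closes the cell of [s]. *)
Lemma step_cell s : tau 0%N < s -> s <= tau n ->
  exists k : 'I_n, tau k < s <= tau k.+1.
Proof.
move=> s0.
have : forall j, (j <= n)%N -> s <= tau j -> exists k : 'I_n, tau k < s <= tau k.+1.
  elim=> [|j IH] jn sj; first by have := lt_le_trans s0 sj; rewrite ltxx.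
  have [sj'|js] := leP s (tau j); first exact: IH (ltnW jn) sj'.
  by exists (Ordinal jn); rewrite /= js.
exact.
Qed.

Lemma step_sum (c : 'I_n -> R) (k : 'I_n) (s : R) : tau k < s <= tau k.+1 ->
  \sum_(i < n) c i * \1_(`]tau i, tau i.+1]%classic) s = c k.
Proof.
move=> sk; rewrite (bigD1 k)//= [X in _ + X]big1 ?addr0.
  by rewrite indicE mem_set ?mulr1//= in_itv.
move=> i ik; rewrite indicE memNset ?mulr0//= in_itv/= => /andP[is_ si].
have /andP[ks sk'] := sk.
have [ik'|ki|/val_inj e] := ltngtP i k.
- have := lt_le_trans ks (le_trans si (step_mono ik' (ltnW (ltn_ord k)))).
  by rewrite ltxx.
- have := lt_le_trans is_ (le_trans sk' (step_mono ki (ltnW (ltn_ord i)))).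
  by rewrite ltxx.
- by rewrite e eqxx in ik.
Qed.

Lemma integral_step (e : 'I_n -> R) : (forall i, 0 <= e i) ->
  (\int[lebesgue_measure]_(s in `]tau 0%N, tau n])
     (\sum_(i < n) e i * \1_(`]tau i, tau i.+1]%classic) s)%:E)%E =
  (\sum_(i < n) e i * (tau i.+1 - tau i))%:E.
Proof.
move=> e0.
under eq_integral do rewrite -sumEFin.
rewrite ge0_integral_sum//=; last 2 first.
- move=> i; apply/measurable_EFinP; apply: measurable_funM => //.
- by move=> i s _; rewrite lee_fin mulr_ge0.
rewrite -sumEFin; apply: eq_bigr => i _.
under eq_integral do rewrite EFinM.
rewrite ge0_integralZl//=; last 2 first.
- exact/measurable_EFinP.
- by rewrite lee_fin.
rewrite integral_indic//= (_ : _ `&` _ = `]tau i, tau i.+1]%classic); last first.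
  apply/setIidPl => s /=; rewrite !in_itv/= => /andP[is_ si].
  rewrite (le_lt_trans (step_mono (leq0n i) (ltnW (ltn_ord i))) is_).
  exact: le_trans si (step_mono (ltn_ord i) (leqnn n)).
rewrite lebesgue_measure_itv/= lte_fin; case: ltP => [_|ii].
  by rewrite -EFinB -EFinM.
rewrite mule0 (_ : tau i.+1 - tau i = 0) ?mulr0//.
by apply/eqP; rewrite subr_eq0 eq_le ii mono.
Qed.

End step_functions.

Section ito_integrals.
Context (R : realType) d (T : measurableType d) (P : probability T R) (m : nat).
Variable W : 'I_m -> R -> T -> R.
Hypothesis HW : is_brownian P W.

Local Notation L1 := (Lfun P 1).
Local Notation L2 := (Lfun P 2%:E).
Local Notation increment := (increment W).

Lemma cvg_lt_eps (u : nat -> \bar R) (eps : R) : 0 < eps -> u @ \oo --> 0%E ->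
  exists p, (u p < eps%:E)%E.
Proof.
move=> eps0 u0.
have : \forall x \near (0%E : \bar R), (x < eps%:E)%E.
  by apply: open_nbhs_nbhs; split; [exact: open_ereal_lt_ereal|rewrite /= lte_fin].
by move=> /u0 [p _ up]; exists p; apply: up => /=.
Qed.

(** For [c = 0] the sum is the simple integral itself; for [c = 1] it is the
    difference with the Brownian increment ([simple_integral_sub1]). *)
Lemma simple_step alpha t (H : simple_process R T) (c : R) : is_simple W t H ->
  let S w := \sum_(k < sp_size H) (sp_coef H k w - c) *
                increment alpha (sp_time H k) (sp_time H k.+1) w in
  [/\ S \in L2, mean P S = 0 & mean P (fun w => S w ^+ 2) =
      \sum_(k < sp_size H) mean P (fun w => (sp_coef H k w - c) ^+ 2) *
                           (sp_time H k.+1 - sp_time H k)].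
Proof.
move=> [tau0 taut mono bnd ad].
have [|||_ _ S2 ES ESS] := @step_integral_isometry _ _ _ _ _ _ HW alpha (sp_size H)
  (sp_time H) (fun k w => sp_coef H k w - c) _ mono.
- by rewrite tau0.
- move=> k kn; have [b cb] := bnd _ kn; exists (b + `|c|) => w.
  by rewrite (le_trans (ler_normB _ _))// lerD2r.
- move=> k kn; apply: (adaptedB _ (@adapted_cst _ _ _ _ _ _ c)) => C mC.
  exact: ad.
- by split.
Qed.

Lemma simple_integralE (H : simple_process R T) alpha w :
  simple_integral H (W alpha) w = \sum_(k < sp_size H) (sp_coef H k w - 0) *
    increment alpha (sp_time H k) (sp_time H k.+1) w.
Proof. by apply: eq_bigr => k _; rewrite subr0. Qed.

Lemma simple_integral_sub1 (H : simple_process R T) alpha t w :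
  is_simple W t H ->
  simple_integral H (W alpha) w - increment alpha 0 t w =
  \sum_(k < sp_size H) (sp_coef H k w - 1) *
    increment alpha (sp_time H k) (sp_time H k.+1) w.
Proof.
move=> [tau0 taut _ _ _].
have -> : increment alpha 0 t w = \sum_(k < sp_size H)
    (W alpha (sp_time H k.+1) w - W alpha (sp_time H k) w).
  rewrite /increment -taut -[in W alpha 0 w]tau0.
  by rewrite -(telescope_sumr (fun k => W alpha (sp_time H k) w))// big_mkord.
rewrite -sumrB; apply: eq_bigr => k _.
by rewrite mulrBl mul1r.
Qed.

(** Simple integrals are centred and square-integrable; both properties pass to
    the limit in mean square. *)
Lemma ito_integral_centered alpha t (G : R -> T -> R) (Y : T -> R) :
  measurable_fun setT Y -> is_ito_integral P W alpha t G Y ->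
  Y \in L2 /\ mean P Y = 0.
Proof.
move=> mY [H [simpleH _ cvY]].
have S2 p : (fun w => simple_integral (H p) (W alpha) w) \in L2.
  have [S2 _ _] := simple_step alpha 0 (simpleH p).
  by under eq_fun do rewrite simple_integralE.
have ES p : mean P (simple_integral (H p) (W alpha)) = 0.
  have [_ <- _] := simple_step alpha 0 (simpleH p).
  by congr mean; apply/funext => w; exact: simple_integralE.
have D2 p :
    ('E_P[fun w => ((simple_integral (H p) (W alpha) w - Y w) ^+ 2)%R] < +oo)%E ->
    (fun w => simple_integral (H p) (W alpha) w - Y w) \in L2.
  move=> h; apply: Lfun2_sqr_lty => //; apply: measurable_funB => //.
  exact: Lfun_measurable (S2 p).
have Y2 : Y \in L2.
  have [p up] := cvg_lt_eps ltr01 cvY.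
  have := Lfun2B (S2 p) (D2 p (lt_trans up (ltry _))).
  by under eq_fun do rewrite subKr.
split => //; apply/eqP; apply/negPn/negP => EY0.
have eps0 : 0 < mean P Y ^+ 2 by rewrite exprn_even_gt0.
have [p up] := cvg_lt_eps eps0 cvY.
have D2p := D2 p (lt_trans up (ltry _)).
move: up; rewrite meanE ?Lfun2_sqr// lte_fin ltNge => /negP; apply.
apply: le_trans (mean_sqr_le D2p).
have -> : mean P (fun w => simple_integral (H p) (W alpha) w - Y w) = - mean P Y.
  under eq_fun do rewrite -mulN1r.
  by rewrite meanD ?Lfun1Z ?Lfun2_Lfun1// meanZ ?Lfun2_Lfun1// ES add0r mulN1r.
by rewrite sqrrN.
Qed.

(** The right-hand side is the one of the isometry for the coefficients
    [sp_coef H k - 1]. *)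
Lemma integral_simple_dist t (H : simple_process R T) : is_simple W t H ->
  (\int[lebesgue_measure]_(s in `[0%R, t])
     'E_P[fun w => ((simple_val H s w - 1) ^+ 2)%R])%E =
  (\sum_(k < sp_size H) mean P (fun w => (sp_coef H k w - 1) ^+ 2) *
     (sp_time H k.+1 - sp_time H k))%:E.
Proof.
move=> HS; have [tau0 taut mono bnd ad] := HS.
pose e (k : 'I_(sp_size H)) := mean P (fun w => (sp_coef H k w - 1) ^+ 2).
have c2 (k : 'I_(sp_size H)) : sp_coef H k \in L2.
  have [c kc] := bnd _ (ltn_ord k); apply: Lfun2_bounded kc.
  by apply: (past_measurable HW (s := sp_time H k)) => C mC; exact: ad.
rewrite -(integral_step mono (e := e)); last first.
  by move=> k; apply: mean_ge0 => w; rewrite sqr_ge0.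
rewrite tau0 taut.
have E s : s \in `]0, t]%classic ->
  (\sum_(i < sp_size H) e i * \1_(`]sp_time H i, sp_time H i.+1]%classic) s)%:E =
  'E_P[fun w => ((simple_val H s w - 1) ^+ 2)%R]%E.
  rewrite inE /= in_itv/= => /andP[s0 st].
  have [||k sk] := @step_cell _ (sp_size H) (sp_time H) s; rewrite ?tau0 ?taut//.
  rewrite (step_sum mono e sk) /e -meanE; last first.
    by apply: Lfun2_sqr; apply: Lfun2B; [exact: c2|exact: Lfun_cst].
  congr ('E_P[_])%E; apply/funext => w.
  by rewrite /simple_val (step_sum mono (fun k => sp_coef H k w) sk).
rewrite -integral_itv_obnd_cbnd.
  by apply: eq_integral => s /E ->.
apply: eq_measurable_fun E _; apply/measurable_EFinP/measurable_funTS.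
apply: measurable_sum => i; apply: measurable_funM => //.
Qed.

(** If simple processes approach [1], then by the isometry their integrals
    approach the increment; they also approach [Y], and the two limits agree. *)
Lemma ito_integral_one alpha t (G : R -> T -> R) (Y : T -> R) : 0 <= t ->
  (forall s w, 0 <= s -> G s w = 1) ->
  measurable_fun setT Y -> is_ito_integral P W alpha t G Y ->
  Y = increment alpha 0 t %[ae P].
Proof.
move=> t0 G1 mY ito; have [Y2 _] := ito_integral_centered mY ito.
case: ito => H [simpleH cvG cvY].
have I2 : increment alpha 0 t \in L2 by exact: (increment_Lfun2 HW alpha (lexx 0) t0).
have D2 := Lfun2B Y2 I2.
have D0 : mean P (fun w => (Y w - increment alpha 0 t w) ^+ 2) = 0.
  apply/eqP; rewrite -[_ == _]negbK; apply/negP => D0.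
  have eps0 : 0 < mean P (fun w => (Y w - increment alpha 0 t w) ^+ 2) / 4.
    rewrite divr_gt0// lt_def D0 mean_ge0// => w; exact: sqr_ge0.
  (* a single index [p] must make both distances small, hence the sum of the
     two sequences; the factor 4 is that of [(x + y)^2 <= 2 x^2 + 2 y^2] *)
  have cv2 : (fun p =>
      (\int[lebesgue_measure]_(s in `[0%R, t])
         'E_P[fun w => ((simple_val (H p) s w - G s w) ^+ 2)%R] +
       'E_P[fun w => ((simple_integral (H p) (W alpha) w - Y w) ^+ 2)%R])%E)
      @ \oo --> 0%E.
    by rewrite -[X in _ --> X]adde0; apply: cvgeD.
  have [p up] := cvg_lt_eps eps0 cv2.
  have HS := simpleH p.
  have intE : (\int[lebesgue_measure]_(s in `[0%R, t])
      'E_P[fun w => ((simple_val (H p) s w - G s w) ^+ 2)%R])%E =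
      (mean P (fun w => (simple_integral (H p) (W alpha) w -
                         increment alpha 0 t w) ^+ 2))%:E.
    transitivity (\int[lebesgue_measure]_(s in `[0%R, t])
      'E_P[fun w => ((simple_val (H p) s w - 1) ^+ 2)%R])%E.
      apply: eq_integral => s; rewrite inE/= in_itv/= => /andP[s0 _].
      by congr ('E_P[_])%E; apply/funext => w; rewrite G1.
    rewrite integral_simple_dist//; congr EFin.
    have [_ _ <-] := simple_step alpha 1 HS; congr mean; apply/funext => w.
    by rewrite (simple_integral_sub1 _ _ HS).
  pose S w := simple_integral (H p) (W alpha) w.
  have S2 : S \in L2.
    have [S2 _ _] := simple_step alpha 0 HS.
    by rewrite /S; under eq_fun do rewrite simple_integralE.
  have SI2 := Lfun2B S2 I2; have SY2 := Lfun2B S2 Y2.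
  move: up; rewrite intE meanE ?Lfun2_sqr// -EFinD lte_fin.
  apply/negP; rewrite -leNgt ler_pdivrMr//.
  rewrite mulrDl -!(mulrC 4) -!meanZ ?Lfun2_sqr// -meanD ?Lfun1Z ?Lfun2_sqr//.
  rewrite -lee_fin -!meanE ?Lfun1D ?Lfun1Z ?Lfun2_sqr//.
  have mS2 X : X \in L2 -> measurable_fun setT (fun w => X w ^+ 2).
    by move=> /Lfun_measurable mX; exact: measurable_funX.
  apply: expectation_le.
  - exact: mS2.
  - by apply: measurable_funD; apply: measurable_funM => //; exact: mS2.
  - by move=> w; rewrite sqr_ge0.
  - by move=> w; rewrite addr_ge0// mulr_ge0// sqr_ge0.
  - apply/nearW => w; rewrite -/(S w).
    have : 0 <= ((S w - Y w) + (S w - increment alpha 0 t w)) ^+ 2 by rewrite sqr_ge0.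
    have : 0 <= (Y w - increment alpha 0 t w) ^+ 2 by rewrite sqr_ge0.
    have : 0 <= (S w - Y w) ^+ 2 by rewrite sqr_ge0.
    have : 0 <= (S w - increment alpha 0 t w) ^+ 2 by rewrite sqr_ge0.
    nra.
have mD : measurable_fun setT (fun w => (Y w - increment alpha 0 t w) ^+ 2).
  by apply: measurable_funX; exact: Lfun_measurable D2.
have : (\int[P]_w `|((Y w - increment alpha 0 t w) ^+ 2)%:E| = 0)%E.
  under eq_integral do rewrite gee0_abs ?lee_fin ?sqr_ge0//.
  have := meanE (Lfun2_sqr D2); by rewrite D0 unlock => ->.
have mDE : measurable_fun setT (fun w => ((Y w - increment alpha 0 t w) ^+ 2)%:E).
  exact/measurable_EFinP.
move/(ae_eq_integral_abs _ measurableT mDE); apply: filterS => w /= D _.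
have /eqP := EFin_inj (D I).
by rewrite sqrf_eq0 subr_eq0 => /eqP.
Qed.

End ito_integrals.

Section iterated_integrals.
Context (R : realType) d (T : measurableType d) (P : probability T R) (m : nat).
Variables (W : 'I_m -> R -> T -> R) (I : multi_index m -> R -> T -> R).
Hypotheses (HW : is_brownian P W) (HI : is_iterated_ito P W I).

Local Notation L2 := (Lfun P 2%:E).

Lemma iterated_measurable xi t : 0 <= t -> measurable_fun setT (I xi t).
Proof.
case: HI => mI _ _ _ t0.
rewrite (_ : I xi t = (fun z : measurableTypeR R * T => I xi z.1 z.2) \o
  (fun w => (t, w)))//.
apply: (measurable_comp (F := (`[0%R, +oo[%classic : set (measurableTypeR R))
  `*` [set: T])).
- by apply: measurableX => //; exact: measurable_itv.
- by move=> _ [w _ <-]; split => //=; rewrite in_itv/= t0.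
- exact: mI.
- exact: measurable_fun_pair.
Qed.

Lemma iterated_time t : 0 <= t -> {ae P, forall w, I [:: ord0] t w = t}.
Proof.
move=> t0; case: HI => _ I1 It _; have := It [::] t t0.
apply: filterS => w /= ->.
transitivity (\int[lebesgue_measure]_(s in `[0%R, t]) (cst 1 s : R)).
  by apply: eq_Rintegral => s; rewrite inE/= in_itv/= => /andP[s0 _]; exact: I1.
rewrite Rintegral_cst// mul1r /= lebesgue_measure_itv/= lte_fin.
by case: ltP => [_|t0']; rewrite /= ?subr0//; apply/eqP; rewrite eq_le t0.
Qed.

Lemma iterated_centered xi alpha t : 0 <= t ->
  I (rcons xi (lift ord0 alpha)) t \in L2 /\
  mean P (I (rcons xi (lift ord0 alpha)) t) = 0.
Proof.
move=> t0; case: HI => _ _ _ ito; have := ito xi alpha t t0.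
by apply: (ito_integral_centered HW); exact: iterated_measurable.
Qed.

Lemma iterated_one alpha t : 0 <= t ->
  I [:: lift ord0 alpha] t = increment W alpha 0 t %[ae P].
Proof.
move=> t0; case: HI => _ I1 _ ito.
apply: (ito_integral_one HW t0 (G := I [::])).
- by move=> s w s0; exact: I1.
- exact: iterated_measurable.
- exact: (ito [::]).
Qed.

Lemma iterated_one_cov alpha beta t : 0 < t ->
  mean P (fun w => I [:: lift ord0 alpha] t w * I [:: lift ord0 beta] t w) =
  (alpha == beta)%:R * t.
Proof.
move=> t0; have t0' := ltW t0.
have -> : mean P (fun w => I [:: lift ord0 alpha] t w * I [:: lift ord0 beta] t w) =
    mean P (fun w => increment W alpha 0 t w * increment W beta 0 t w).
  rewrite /mean unlock; congr fine; apply: ae_eq_integral => //.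
  - by apply/measurable_EFinP; apply: measurable_funM; exact: iterated_measurable.
  - by apply/measurable_EFinP; apply: measurable_funM; exact: (increment_measurable HW).
  - apply: filterS2 (iterated_one alpha t0') (iterated_one beta t0') => w /=.
    by move=> -> // ->.
have I1 : cst 1 \in Lfun P 1 by exact: Lfun_cst.
case: eqVneq => [<-|ab].
  have [_ _ _] := increment_moments HW alpha (lexx 0) t0'
    (@adapted_cst _ _ _ _ W `[0, 0]%classic 1) I1.
  rewrite (mean_cst P 1) subr0 => <-; congr mean; apply/funext => w.
  by rewrite mul1r expr2.
have r0 : 0 < Num.sqrt t by rewrite sqrtr_gt0.
have ia : P.-integrable setT (EFin \o increment W alpha 0 t).
  by apply/Lfun1_integrable/Lfun2_Lfun1; exact: (increment_Lfun2 HW).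
have mb := increment_measurable HW beta (lexx 0) t0'.
have [_ E] := independent_integral mb
  (fun A C => increments_independent HW t0 ab (A := A) (C := C)) ia
  (normal_prob_integrable_id r0).
by rewrite mul0r /mean unlock E normal_prob_mean// mule0.
Qed.

End iterated_integrals.

(** * Calculus on row vectors *)

Section row_calculus.
Variable R : realType.

Lemma diff_sum_partial (N p : nat) (f : 'rV[R]_N -> 'rV[R]_p) (x v : 'rV[R]_N) :
  differentiable f x -> \sum_(i < N) v 0 i *: partial i f x = 'd f x v.
Proof.
move=> df; rewrite {2}(row_sum_delta v) linear_sum; apply: eq_bigr => i _.
by rewrite linearZ /partial deriveE.
Qed.

Lemma differentiable_entry (V : normedModType R) (p : nat) (f : V -> 'rV[R]_p)
    (x : V) (j : 'I_p) :
  differentiable f x -> differentiable (fun z => f z 0 j) x.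
Proof.
move=> df; apply: (differentiable_comp (g := fun M : 'rV[R]_p => M 0 j)) => //.
exact: differentiable_coord.
Qed.

Lemma differentiable_row (V : normedModType R) (p : nat) (f : V -> 'rV[R]_p)
    (x : V) :
  (forall j, differentiable (fun z => f z 0 j) x) -> differentiable f x.
Proof.
move=> df.
have -> : f = \sum_(j < p) (fun z => f z 0 j *: delta_mx 0 j).
  by apply/funext => z; rewrite fct_sumE {1}(row_sum_delta (f z)).
by apply: differentiable_sum => j; exact: differentiableZl.
Qed.

Lemma differentiable_scale (V : normedModType R) (p : nat) (k : V -> R)
    (f : V -> 'rV[R]_p) (x : V) :
  differentiable k x -> differentiable f x ->
  differentiable (fun z => k z *: f z) x.
Proof.
move=> dk df; apply: differentiable_row => j.
have -> : (fun z => (k z *: f z) 0 j) = k * (fun z => f z 0 j).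
  by apply/funext => z; rewrite mxE.
by apply: differentiableM => //; exact: differentiable_entry.
Qed.

Lemma diff_lsubmx (r n : nat) (z : 'rV[R]_(r + n)) :
  'd (@lsubmx R 1 r n) z = @lsubmx R 1 r n :> ('rV_(r + n) -> 'rV_r).
Proof.
exact: (diff_lin _ (@continuous_lsubmx _ _ _ _)).
Qed.

Lemma diff_rsubmx (r n : nat) (z : 'rV[R]_(r + n)) :
  'd (@rsubmx R 1 r n) z = @rsubmx R 1 r n :> ('rV_(r + n) -> 'rV_n).
Proof.
exact: (diff_lin _ (@continuous_rsubmx _ _ _ _)).
Qed.

Lemma is_diff_sub_stack (r n p : nat) (f : 'rV[R]_r -> 'rV[R]_p)
    (F : 'rV[R]_n -> 'rV[R]_p) (x : 'rV[R]_r) (y : 'rV[R]_n) :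
  differentiable f x -> differentiable F y ->
  is_diff (row_mx x y) (fun z => f (lsubmx z) - F (rsubmx z))
    (fun v => 'd f x (lsubmx v) - 'd F y (rsubmx v)).
Proof.
move=> df dF.
have dl : is_diff (row_mx x y) (f \o lsubmx) ('d f x \o lsubmx).
  have df' : differentiable f (lsubmx (row_mx x y)) by rewrite row_mxKl.
  apply: DiffDef; first by apply: differentiable_comp => //; exact: differentiable_lsubmx.
  rewrite diff_comp//; last exact: differentiable_lsubmx.
  by rewrite row_mxKl diff_lsubmx.
have dr : is_diff (row_mx x y) (F \o rsubmx) ('d F y \o rsubmx).
  have dF' : differentiable F (rsubmx (row_mx x y)) by rewrite row_mxKr.
  apply: DiffDef; first by apply: differentiable_comp => //; exact: differentiable_rsubmx.
  rewrite diff_comp//; last exact: differentiable_rsubmx.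
  by rewrite row_mxKr diff_rsubmx.
exact: is_diffB.
Qed.

End row_calculus.

Section least_squares.
Variables (R : realType) (n p : nat).

Lemma dotvC (N : nat) (u v : 'rV[R]_N) : dotv u v = dotv v u.
Proof. by apply: eq_bigr => i _; rewrite mulrC. Qed.

Lemma dotvDl (N : nat) (u v w : 'rV[R]_N) : dotv (u + v) w = dotv u w + dotv v w.
Proof. by rewrite -big_split; apply: eq_bigr => i _; rewrite !mxE mulrDl. Qed.

Lemma dotvNl (N : nat) (u w : 'rV[R]_N) : dotv (- u) w = - dotv u w.
Proof. by rewrite -sumrN; apply: eq_bigr => i _; rewrite mxE mulNr. Qed.

Lemma sqnormv_ge0 (N : nat) (u : 'rV[R]_N) : 0 <= sqnormv u.
Proof. by apply: sumr_ge0 => i _; rewrite -expr2 sqr_ge0. Qed.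

Lemma sqnormv_le0 (N : nat) (u : 'rV[R]_N) : sqnormv u <= 0 -> u = 0.
Proof.
move=> u0; have /eqP : sqnormv u = 0 by apply/eqP; rewrite eq_le u0 sqnormv_ge0.
rewrite psumr_eq0 => [|i _]; last by rewrite -expr2 sqr_ge0.
move=> /allP u0i; apply/rowP => i; rewrite mxE.
by have := u0i i (mem_index_enum i); rewrite /= mulf_eq0 orbb => /eqP.
Qed.

Lemma sqnormvD (N : nat) (u v : 'rV[R]_N) :
  sqnormv (u + v) = sqnormv u + 2 * dotv u v + sqnormv v.
Proof.
rewrite /sqnormv dotvDl (dotvC u) (dotvC v (u + v)) !dotvDl (dotvC v u).
by ring.
Qed.

(** The parallelogram law. *)
Lemma sqnormv_reflect (N : nat) (u c : 'rV[R]_N) :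
  sqnormv (u + c) + sqnormv (- u + c) = 2 * (sqnormv u + sqnormv c).
Proof.
rewrite !sqnormvD dotvNl /sqnormv dotvNl (dotvC u (- u)) dotvNl.
by ring.
Qed.

(** Pythagoras' theorem: the residual [e - L b0] is orthogonal to the range. *)
Lemma sqnormv_residual (L : {linear 'rV[R]_n -> 'rV[R]_p}) (e : 'rV[R]_p)
    (b0 b : 'rV[R]_n) :
  (forall w, dotv (e - L b0) (L w) = 0) ->
  sqnormv (e - L b) = sqnormv (e - L b0) + sqnormv (L (b0 - b)).
Proof.
move=> res; have -> : e - L b = (e - L b0) + L (b0 - b).
  by rewrite linearB /= addrA subrK.
by rewrite sqnormvD res mulr0 addr0.
Qed.

End least_squares.

Section near_calculus.
Variables (R : realType) (V W : normedModType R).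

(** The difference [g - f] vanishes near [x], hence is negligible with respect
    to any function. *)
Lemma near_eq_is_diff (f g df : V -> W) (x : V) : {near x, f =1 g} ->
  is_diff x f df -> is_diff x g df.
Proof.
move=> fg fdf; pose e := g - f.
have e0 : \near x, e x = 0 by apply: filterS fg => y E; rewrite /e !fctE E subrr.
have ex0 : e x = 0 := nbhs_singleton e0.
have eo (h : V -> V) : e = cst 0 +o_ x h.
  apply/eqaddoP => eps eps0; apply: filterS e0 => y E.
  by rewrite !fctE E subr0 normr0 mulr_ge0// ltW.
have de : differentiable e x.
  apply/diffP; apply: (@getPex _ (fun (df : {linear V -> W}) => continuous df /\
    forall y, e y = e (lim (nbhs x)) + df (y - lim (nbhs x))
                  +o_(y \near x) (y - lim (nbhs x)))).
  exists ('d (cst (0 : W)) x); split; first by rewrite diff_cst; exact: cst_continuous.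
  apply: eqaddoEx => y; rewrite lim_id// ex0 add0r diff_cst.
  by have := eo (fun z => z - x); rewrite funeqE => ->.
have -> : g = f + e by rewrite /e addrC subrK.
have e' : is_diff x e (0 : V -> W).
  apply: DiffDef => //; apply/funext => v.
  by rewrite -deriveE// (near_eq_derive (g := cst 0) v e0) derive_cst.
have := is_diffD fdf e'.
by rewrite addr0.
Qed.

End near_calculus.

(** * Charts and the metric projection *)

Lemma derive_comp (R : realType) (U V W : normedModType R) (f : U -> V)
    (g : V -> W) (x v : U) : differentiable f x -> differentiable g (f x) ->
  'D_v (g \o f) x = 'd g (f x) ('D_v f x).
Proof.
move=> df dg; rewrite !deriveE//; first by rewrite diff_comp.
exact: differentiable_comp.
Qed.

Lemma near_preimage (R : realType) (V W : normedModType R) (f : V -> W) (x : V)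
    (A : set W) :
  differentiable f x -> open A -> A (f x) -> \forall z \near x, A (f z).
Proof.
move=> df oA Afx; have := differentiable_continuous df.
by apply; apply: open_nbhs_nbhs.
Qed.

Section chart_geometry.
Variables (R : realType) (r n : nat) (M U : set 'rV[R]_r)
  (psi : 'rV[R]_r -> 'rV[R]_n) (phi : 'rV[R]_n -> 'rV[R]_r).
Hypothesis Hchart : is_chart M U psi phi.
Let V := psi @` U.

Lemma smooth_on_differentiable (N p : nat) (O : set 'rV[R]_N)
    (f : 'rV[R]_N -> 'rV[R]_p) x : smooth_on O f -> O x -> differentiable f x.
Proof. by move=> /(_ 1%N)[df _]; exact: df. Qed.

Lemma smooth_on_derive (N p : nat) (O : set 'rV[R]_N)
    (f : 'rV[R]_N -> 'rV[R]_p) v : smooth_on O f -> smooth_on O (fun x => 'D_v f x).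
Proof. by move=> sf k; have [_] := sf k.+1; exact. Qed.

Lemma chart_domain_open : exists2 O, open O & U = M `&` O.
Proof. by have [[A [oA ->]] _ _ _ _] := Hchart; exists A. Qed.

Lemma chart_sub x : U x -> M x.
Proof. by have [A _ ->] := chart_domain_open; case. Qed.

Lemma chart_image_open : open V.
Proof. by case: Hchart. Qed.

Lemma chart_phiK x : U x -> phi (psi x) = x.
Proof. by case: Hchart => _ _ _ _; exact. Qed.

Lemma chart_psiK y : V y -> psi (phi y) = y.
Proof. by move=> [x Ux <-]; rewrite chart_phiK. Qed.

Lemma chart_phi_in y : V y -> U (phi y).
Proof. by move=> [x Ux <-]; rewrite chart_phiK. Qed.

Lemma chart_phi_smooth : smooth_on V phi.
Proof. by case: Hchart. Qed.

Lemma chart_phi_differentiable y : V y -> differentiable phi y.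
Proof. exact: smooth_on_differentiable chart_phi_smooth. Qed.

Lemma near_chart y : V y -> \near y, V y.
Proof. by move=> Vy; apply: open_nbhs_nbhs; split => //; exact: chart_image_open. Qed.

(** The chart [psi] is differentiable through a smooth extension [h] only. *)
Section at_point.
Variables (x0 : 'rV[R]_r) (O : set 'rV[R]_r) (h : 'rV[R]_r -> 'rV[R]_n).
Hypotheses (Ux0 : U x0) (oO : open O) (Ox0 : O x0) (sh : smooth_on O h)
  (hE : forall z, U z -> O z -> h z = psi z).
Let y0 := psi x0.

Let Vy0 : V y0. Proof. by exists x0. Qed.
Let dphi : differentiable phi y0. Proof. exact: chart_phi_differentiable. Qed.
Let dh : differentiable h x0. Proof. exact: smooth_on_differentiable sh Ox0. Qed.
Let phiy0 : phi y0 = x0. Proof. exact: chart_phiK. Qed.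

Lemma diff_chart_inverse w : 'd h x0 ('d phi y0 w) = w.
Proof.
have id_near : \near y0, (h \o phi) y0 = id y0.
  have : \near y0, O (phi y0) by apply: near_preimage => //; rewrite phiy0.
  apply: filterS2 (near_chart Vy0) => y Vy Oy /=.
  by rewrite hE// ?chart_psiK//; exact: chart_phi_in.
have dh' : differentiable h (phi y0) by rewrite phiy0.
transitivity ('D_w (h \o phi) y0).
  by rewrite derive_comp// phiy0 deriveE.
by rewrite (near_eq_derive w id_near) derive_id.
Qed.

(** A differentiable curve in [M] stays in [U] near time 0, where it is
    recovered by [phi] from its image under [psi]. *)
Lemma curve_in_chart v gamma : curve_through M x0 v gamma ->
  is_derive (0 : R) (1 : R) (psi \o gamma) ('d h x0 v) /\
  v = 'd phi y0 ('d h x0 v).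
Proof.
move=> [g0 gM dg]; have [A' oA' UE] := chart_domain_open.
have dg' : differentiable gamma 0 by apply/derivable1_diffP; exact: ex_derive.
have g1 : 'd gamma 0 1 = v by rewrite -deriveE// derive_val.
have near_in (A : set 'rV[R]_r) : open A -> A x0 -> \forall t \near (0 : R), A (gamma t).
  by move=> oA Ax0; apply: near_preimage => //; rewrite g0.
have A'x0 : A' x0 by move: Ux0; rewrite UE => -[].
have gU : \forall t \near (0 : R), U (gamma t).
  by rewrite UE; apply: filterS2 gM (near_in _ oA' A'x0).
have hg : \forall t \near (0 : R), (h \o gamma) t = (psi \o gamma) t.
  by apply: filterS2 gU (near_in _ oO Ox0) => t Ut Ot /=; exact: hE.
have dhg : differentiable h (gamma 0) by rewrite g0.
have D1 : is_derive (0 : R) (1 : R) (h \o gamma) ('d h x0 v).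
  have dc := differentiable_comp dg' dhg.
  apply: DeriveDef; first exact: diff_derivable.
  by rewrite derive_comp// g0 deriveE// g1.
have D2 := near_eq_is_derive hg D1.
split => //.
have pg : \forall t \near (0 : R), (phi \o (psi \o gamma)) t = gamma t.
  by apply: filterS gU => t Ut /=; rewrite chart_phiK.
have dpsi : differentiable (psi \o gamma) 0 by apply/derivable1_diffP; exact: ex_derive.
have dphi' : differentiable phi ((psi \o gamma) 0) by rewrite /= g0.
transitivity ('D_(1 : R) gamma 0); first by rewrite derive_val.
by rewrite -(near_eq_derive (1 : R) pg) derive_comp// derive_val /= g0.
Qed.

Lemma curve_of_chart w :
  curve_through M x0 ('d phi y0 w) (fun t => phi (y0 + t *: w)).
Proof.
pose l (t : R) : 'rV[R]_n := y0 + t *: w.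
have l0 : l 0 = y0 by rewrite /l scale0r addr0.
have dl : is_diff (0 : R) l (fun t => t *: w).
  by apply: is_diff_eq; rewrite add0r.
have dphi' : differentiable phi (l 0) by rewrite l0.
split; first by rewrite -/(l 0) l0.
  have lV : \forall t \near (0 : R), V (l t).
    by apply: near_preimage => //; [exact: chart_image_open|rewrite l0].
  by apply: filterS lV => t /chart_phi_in/chart_sub.
have dc : differentiable (phi \o l) 0 by exact: differentiable_comp.
apply: (@DeriveDef _ _ _ _ _ (phi \o l)); first exact: diff_derivable.
by rewrite derive_comp// l0 deriveE// diff_val scale1r.
Qed.

(** One inclusion by [curve_in_chart], the other by the images under [phi] of
    line segments. *)
Lemma tangentP v : tangent_space M x0 v <-> exists w, v = 'd phi y0 w.
Proof.
split=> [[gamma /curve_in_chart[_ ->]]|[w ->]]; first by exists ('d h x0 v).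
by exists (fun t => phi (y0 + t *: w)); exact: curve_of_chart.
Qed.

Lemma push_forward_tangent v : tangent_space M x0 v ->
  push_forward M psi x0 v = 'd h x0 v.
Proof.
move=> [gamma cg]; apply: xget_unique.
  by exists gamma; split => //; have [] := curve_in_chart cg.
move=> w [gamma' [/curve_in_chart[[_ <-] _] [_ <-]]].
by [].
Qed.

End at_point.

End chart_geometry.

Lemma derive_entry (R : realType) (V : normedModType R) (p : nat)
    (f : V -> 'rV[R]_p) (x v : V) (i : 'I_p) : differentiable f x ->
  'D_v (fun z => f z 0 i) x = ('D_v f x) 0 i.
Proof. by move=> df; rewrite derive_mx ?mxE//; exact: diff_derivable. Qed.

Lemma is_derive_dotv (R : realType) (V : normedModType R) (p : nat)
    (f g : V -> 'rV[R]_p) (x v : V) : differentiable f x -> differentiable g x ->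
  is_derive x v (fun z => dotv (f z) (g z))
    (dotv ('D_v f x) (g x) + dotv (f x) ('D_v g x)).
Proof.
move=> df dg.
have -> : (fun z => dotv (f z) (g z)) =
    \sum_(i < p) ((fun z => f z 0 i) * (fun z => g z 0 i)).
  by apply/funext => z; rewrite fct_sumE.
have dfi i : is_derive x v (fun z => f z 0 i) (('D_v f x) 0 i).
  apply: DeriveDef; last exact: derive_entry.
  by apply: diff_derivable; exact: differentiable_entry.
have dgi i : is_derive x v (fun z => g z 0 i) (('D_v g x) 0 i).
  apply: DeriveDef; last exact: derive_entry.
  by apply: diff_derivable; exact: differentiable_entry.
apply: is_derive_eq; rewrite -big_split; apply: eq_bigr => i _ /=.
by rewrite addrC; congr (_ + _); exact: mulrC.
Qed.

Section metric_projection.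
Variables (R : realType) (r n : nat) (M U N : set 'rV[R]_r)
  (psi : 'rV[R]_r -> 'rV[R]_n) (phi : 'rV[R]_n -> 'rV[R]_r)
  (Pis : 'rV[R]_r -> 'rV[R]_r).
Hypotheses (Hchart : is_chart M U psi phi)
  (HPis : is_metric_projection M U N Pis).

Lemma metric_projection_id x : U x -> Pis x = x.
Proof.
move=> Ux; have [_ UN _ near_pt] := HPis; have [_ /(_ x)h] := near_pt _ (UN _ Ux).
apply: contrapT => /nesym xP; have := h (chart_sub Hchart Ux) xP.
rewrite [X in _ < X](_ : _ = 0); first by rewrite ltNge sqnormv_ge0.
by rewrite subrr /sqnormv /dotv big1// => i _; rewrite mxE mul0r.
Qed.

Lemma metric_projection_in x : N x -> U (Pis x).
Proof. by have [_ _ _ h] := HPis => /h[]. Qed.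

Lemma metric_projection_le x q : N x -> M q ->
  sqnormv (x - Pis x) <= sqnormv (x - q).
Proof.
have [_ _ _ h] := HPis => /h[_ xq] Mq.
have [->//|/eqP qx] := eqVneq q (Pis x).
exact: ltW (xq _ Mq qx).
Qed.

(** First-order optimality of the nearest point [Pis x] among the points
    [phi (psi (Pis x) + t *: w)]. *)
Lemma metric_projection_normal x w : N x ->
  dotv (x - Pis x) ('d phi (psi (Pis x)) w) = 0.
Proof.
move=> Nx; have Up := metric_projection_in Nx.
pose y := psi (Pis x).
have Vy : (psi @` U) y by exists (Pis x).
pose l (t : R) : 'rV[R]_n := y + t *: w.
have l0 : l 0 = y by rewrite /l scale0r addr0.
have dl t : is_diff (t : R) l (fun t => t *: w).
  by apply: is_diff_eq; rewrite add0r.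
have [e /= e0 He] : \forall t \near (0 : R), (psi @` U) (l t).
  apply: near_preimage => //; first exact: chart_image_open Hchart.
  by rewrite l0.
have Vl t : t \in `](- e), e[ -> (psi @` U) (l t).
  by rewrite in_itv/= => te; apply: He; rewrite /= sub0r normrN ltr_norml.
pose f t := sqnormv (x - phi (l t)).
have df t : t \in `](- e), e[ ->
    is_derive t 1 f (2 * dotv (x - phi (l t)) (- 'd phi (l t) w)).
  move=> te; have dphi := chart_phi_differentiable Hchart (Vl t te).
  have dc : is_derive t 1 (phi \o l) ('d phi (l t) w).
    apply: DeriveDef; first by apply: diff_derivable; exact: differentiable_comp.
    by rewrite derive_comp// deriveE// diff_val scale1r.
  have dg : is_derive t 1 (fun t => x - phi (l t)) (- 'd phi (l t) w).
    by apply: is_derive_eq; rewrite sub0r.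
  have dg' : differentiable (fun t => x - phi (l t)) t.
    by apply/derivable1_diffP; exact: ex_derive.
  have := is_derive_dotv (1 : R) dg' dg'; rewrite derive_val => D.
  by apply: is_derive_eq; rewrite dotvC -mulr2n mulr_natl.
have zero_in : (0 : R) \in `](- e), e[ by rewrite in_itv/= oppr_lt0 e0.
have f_min t : t \in `](- e), e[ -> f 0 <= f t.
  move=> te; rewrite /f l0 (chart_phiK Hchart Up).
  apply: metric_projection_le => //.
  by apply: (chart_sub Hchart); apply: (chart_phi_in Hchart); exact: Vl.
have D0 : is_derive (0 : R) 1 f 0.
  apply: (derive1_at_min (a := - e) (b := e)) => //.
  - by rewrite ge0_cp ?ltW.
  - by move=> t te; have D := df t te; exact: ex_derive.
have D := df 0 zero_in.
have : 2 * dotv (x - phi (l 0)) (- 'd phi (l 0) w) = 0.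
  by rewrite -(@derive_val _ _ _ _ _ _ _ D) (@derive_val _ _ _ _ _ _ _ D0).
rewrite l0 (chart_phiK Hchart Up) dotvC dotvNl dotvC mulrN => /eqP.
by rewrite oppr_eq0 mulf_eq0 pnatr_eq0/= => /eqP.
Qed.

Section at_point.
Variables (x0 : 'rV[R]_r) (O : set 'rV[R]_r) (h : 'rV[R]_r -> 'rV[R]_n).
Hypotheses (Ux0 : U x0) (oO : open O) (Ox0 : O x0) (sh : smooth_on O h)
  (hE : forall z, U z -> O z -> h z = psi z).
Let y0 := psi x0.

Let Nx0 : N x0. Proof. by have [_ UN _ _] := HPis; exact: UN. Qed.
Let oN : open N. Proof. by case: HPis. Qed.
Let sPis : smooth_on N Pis. Proof. by case: HPis. Qed.
Let Vy0 : (psi @` U) y0. Proof. by exists x0. Qed.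
Let dphi : differentiable phi y0. Proof. exact: (chart_phi_differentiable Hchart Vy0). Qed.
Let dh : differentiable h x0. Proof. exact: smooth_on_differentiable sh Ox0. Qed.
Let dPis : differentiable Pis x0. Proof. exact: smooth_on_differentiable sPis Nx0. Qed.
Let Pisx0 : Pis x0 = x0. Proof. exact: metric_projection_id. Qed.
Let hx0 : h x0 = y0. Proof. exact: hE. Qed.

Lemma near_projection x : N x -> O (Pis x) ->
  \forall z \near x, N z /\ O (Pis z).
Proof.
move=> Nx Ox; have dP := smooth_on_differentiable sPis Nx.
have nN : \forall z \near x, N z by apply: open_nbhs_nbhs.
by apply: filterS2 nN (near_preimage dP oO Ox).
Qed.

Let near_x0 : \forall z \near x0, N z /\ O (Pis z).
Proof. by apply: near_projection => //; rewrite Pisx0. Qed.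

(** Differentiating [metric_projection_normal] at [x0]: the term with the
    derivative of [u] is multiplied by [x0 - Pis x0 = 0]. *)
Lemma diff_metric_projection_normal v w :
  dotv (v - 'd Pis x0 v) ('d phi y0 w) = 0.
Proof.
pose u x := 'D_w phi (h (Pis x)).
have du : differentiable u x0.
  have dhP : differentiable h (Pis x0) by rewrite Pisx0.
  have dD : differentiable (fun y => 'D_w phi y) (h (Pis x0)).
    rewrite Pisx0 hx0; apply: smooth_on_differentiable Vy0.
    by apply: smooth_on_derive; exact: (chart_phi_smooth Hchart).
  by have := differentiable_comp (differentiable_comp dPis dhP) dD.
have dk : differentiable (fun x => x - Pis x) x0 by exact: differentiableB.
have k0 : \forall x \near x0, dotv (x - Pis x) (u x) = cst 0 x.
  apply: filterS near_x0 => x [Nx OPx]; rewrite /u deriveE; last first.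
    rewrite hE//; last exact: metric_projection_in.
    apply: (chart_phi_differentiable Hchart); exists (Pis x) => //.
    exact: metric_projection_in.
  by rewrite hE//; [exact: metric_projection_normal|exact: metric_projection_in].
have D := is_derive_dotv v dk du.
have : dotv ('D_v (fun x => x - Pis x) x0) (u x0) +
    dotv (x0 - Pis x0) ('D_v u x0) = 0.
  by rewrite -(@derive_val _ _ _ _ _ _ _ D) (near_eq_derive v k0) derive_cst.
rewrite Pisx0 subrr [X in _ + X](_ : _ = 0) ?addr0; last first.
  by rewrite /dotv big1// => i _; rewrite mxE mul0r.
have DP : is_derive x0 v Pis ('d Pis x0 v).
  by apply: DeriveDef; [exact: diff_derivable|rewrite deriveE].
by rewrite /u Pisx0 hx0 derive_val [X in dotv _ X]deriveE.
Qed.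

(** Because [Pis] takes its values in [U], it equals [phi \o psi \o Pis]. *)
Lemma diff_metric_projection_tangent v :
  'd Pis x0 v = 'd phi y0 ('d h x0 ('d Pis x0 v)).
Proof.
have E : \forall x \near x0, Pis x = (phi \o (h \o Pis)) x.
  apply: filterS near_x0 => x [Nx OPx] /=; have UP := metric_projection_in Nx.
  by rewrite hE// (chart_phiK Hchart).
have dhP : differentiable h (Pis x0) by rewrite Pisx0.
have dphi' : differentiable phi ((h \o Pis) x0) by rewrite /= Pisx0 hx0.
rewrite -{1}deriveE// (near_eq_derive v E) derive_comp//; last first.
  exact: differentiable_comp.
by rewrite derive_comp// /= Pisx0 hx0 deriveE.
Qed.

(** The two preceding lemmas characterize the orthogonal projection; its
    existence in a finite-dimensional tangent space is obtained here from the
    metric projection. *)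
Lemma orth_proj_tangent v : orth_proj (tangent_space M x0) v = 'd Pis x0 v.
Proof.
have tP := tangentP Hchart Ux0 oO Ox0 sh hE.
apply: xget_unique => [|p [Tp pv]] /=.
  split.
    apply/tP; exists ('d h x0 ('d Pis x0 v)).
    exact: diff_metric_projection_tangent.
  by move=> u /tP[w ->]; exact: diff_metric_projection_normal.
have [w pw] := (tP _).1 Tp.
apply/eqP; rewrite -subr_eq0; apply/eqP; apply: sqnormv_le0.
pose w' := w - 'd h x0 ('d Pis x0 v).
have E : p - 'd Pis x0 v = 'd phi y0 w'.
  by rewrite /w' linearB /= -diff_metric_projection_tangent pw.
have Tw' : tangent_space M x0 ('d phi y0 w') by apply/tP; exists w'.
have := diff_metric_projection_normal v w'; have := pv _ Tw'.
rewrite -E !(dotvDl v) !dotvNl => pE qE.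
rewrite /sqnormv dotvDl dotvNl.
by move: pE qE; set a := dotv v _; set b := dotv p _; set c := dotv ('d _ _ _) _; lra.
Qed.

Lemma derive_chart_projection x v : N x -> O (Pis x) ->
  'D_v (psi \o Pis) x = \sum_(j < r) ('D_v Pis x) 0 j *: partial j h (Pis x).
Proof.
move=> Nx OPx.
have E : \forall z \near x, (psi \o Pis) z = (h \o Pis) z.
  apply: filterS (near_projection Nx OPx) => z [Nz OPz] /=.
  by rewrite hE//; exact: metric_projection_in.
have dhP : differentiable h (Pis x) := smooth_on_differentiable sh OPx.
have dP : differentiable Pis x := smooth_on_differentiable sPis Nx.
by rewrite (near_eq_derive v E) derive_comp// diff_sum_partial.
Qed.

Lemma chart_projection_is_diff :
  is_diff x0 (psi \o Pis) ('d h x0 \o 'd Pis x0).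
Proof.
have E : \forall z \near x0, (h \o Pis) z = (psi \o Pis) z.
  apply: filterS near_x0 => z [Nz OPz] /=.
  by rewrite hE//; exact: metric_projection_in.
have dhP : is_diff (Pis x0) h ('d h x0) by rewrite Pisx0; exact: differentiableP.
exact: near_eq_is_diff E (is_diff_comp (differentiableP dPis) dhP).
Qed.

Lemma derive_chart_projection_differentiable v :
  differentiable (fun x => 'D_v (psi \o Pis) x) x0.
Proof.
have E : {near x0, (fun x => \sum_(j < r) ('D_v Pis x) 0 j *: partial j h (Pis x))
    =1 (fun x => 'D_v (psi \o Pis) x)}.
  by apply: filterS near_x0 => x [Nx OPx]; rewrite derive_chart_projection.
have d : differentiable (fun x => \sum_(j < r) ('D_v Pis x) 0 j *: partial j h (Pis x)) x0.
  have -> : (fun x => \sum_(j < r) ('D_v Pis x) 0 j *: partial j h (Pis x)) =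
      \sum_(j < r) (fun x => ('D_v Pis x) 0 j *: partial j h (Pis x)).
    by apply/funext => x; rewrite fct_sumE.
  apply: differentiable_sum => j; apply: differentiable_scale.
    apply: differentiable_entry; apply: smooth_on_differentiable Nx0.
    exact: smooth_on_derive.
  apply: (differentiable_comp (g := partial j h)) => //; rewrite Pisx0.
  by apply: smooth_on_differentiable Ox0; exact: smooth_on_derive.
have D := near_eq_is_diff E (differentiableP d).
exact: ex_diff.
Qed.

End at_point.

End metric_projection.

Section stratonovich_projection.
Variables (R : realType) (r n : nat) (M U N : set 'rV[R]_r)
  (psi : 'rV[R]_r -> 'rV[R]_n) (phi : 'rV[R]_n -> 'rV[R]_r)
  (Pis : 'rV[R]_r -> 'rV[R]_r).
Hypotheses (Hchart : is_chart M U psi phi)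
  (HPis : is_metric_projection M U N Pis).

Definition chart_proj (x v : 'rV[R]_r) : 'rV[R]_n :=
  push_forward M psi x (orth_proj (tangent_space M x) v).

(** The facts used for the optimality, freed from the local extension of
    [psi]. *)
Lemma chart_projP x : U x ->
  [/\ differentiable (psi \o Pis) x,
      forall v, 'd (psi \o Pis) x v = chart_proj x v,
      forall v w, dotv (v - 'd phi (psi x) (chart_proj x v)) ('d phi (psi x) w) = 0,
      forall w, 'd phi (psi x) w = 0 -> w = 0
    & forall v, differentiable (fun z => 'D_v (psi \o Pis) z) x].
Proof.
move=> Ux; have [_ _ spsi _ _] := Hchart.
have [A [h [oA Ax sh hE]]] := spsi x Ux.
have tan v : tangent_space M x ('d Pis x v).
  apply/(tangentP Hchart Ux oA Ax sh hE); exists ('d h x ('d Pis x v)).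
  exact: (diff_metric_projection_tangent Hchart HPis Ux oA Ax sh hE).
have projE v : chart_proj x v = 'd h x ('d Pis x v).
  rewrite /chart_proj (orth_proj_tangent Hchart HPis Ux oA Ax sh hE).
  exact: (push_forward_tangent Hchart Ux oA Ax sh hE).
have D := chart_projection_is_diff Hchart HPis Ux oA Ax sh hE.
split.
- exact: ex_diff.
- move=> v; rewrite projE.
  exact: (congr1 (fun g : _ -> _ => g v) (@diff_val _ _ _ _ _ _ _ D)).
- move=> v w; rewrite projE.
  rewrite -(diff_metric_projection_tangent Hchart HPis Ux oA Ax sh hE).
  exact: (diff_metric_projection_normal Hchart HPis Ux oA Ax sh hE).
- move=> w w0; have := diff_chart_inverse Hchart Ux oA Ax sh hE w.
  by rewrite w0 linear0.
- move=> v.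
  exact: (derive_chart_projection_differentiable Hchart HPis Ux oA Ax sh hE).
Qed.

(** The projected coefficients are the derivatives of the smooth map
    [psi \o Pis] along the coefficients of [X]. *)
Lemma strat_projection_admissible (m : nat) (J : set R) (X : sde R m r) :
  admissible setT J X -> admissible (psi @` U) J (strat_projection M psi phi X).
Proof.
move=> HX alpha t y Jt Vy.
have dphi := chart_phi_differentiable Hchart Vy.
have Uphi := chart_phi_in Hchart Vy.
pose b z := diffusion X alpha (phi z) t.
have db : differentiable b y.
  apply: (differentiable_comp (g := fun x => diffusion X alpha x t)) => //.
  exact: HX.
have d : differentiable
    (fun z => \sum_(i < r) b z 0 i *: partial i (psi \o Pis) (phi z)) y.
  have -> : (fun z => \sum_(i < r) b z 0 i *: partial i (psi \o Pis) (phi z)) =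
      \sum_(i < r) (fun z => b z 0 i *: partial i (psi \o Pis) (phi z)).
    by apply/funext => z; rewrite fct_sumE.
  apply: differentiable_sum => i; apply: differentiable_scale.
    exact: differentiable_entry.
  apply: (differentiable_comp (g := partial i (psi \o Pis))) => //.
  by have [_ _ _ _] := chart_projP Uphi; exact.
have E : {near y, (fun z => \sum_(i < r) b z 0 i *: partial i (psi \o Pis) (phi z))
    =1 (fun z => diffusion (strat_projection M psi phi X) alpha z t)}.
  apply: filterS (near_chart Hchart Vy) => z /(chart_phi_in Hchart) Uz.
  have [dP PE _ _ _] := chart_projP Uz.
  by rewrite diff_sum_partial// PE.
have D := near_eq_is_diff E (differentiableP d).
exact: ex_diff.
Qed.

End stratonovich_projection.

(** * Terms of the expansions *)

Section ito_taylor_terms.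
Variables (R : realType) (Omega : Type) (m N p : nat).
Implicit Types (X : sde R m N) (g : 'rV[R]_N -> R -> 'rV[R]_p).

Lemma sum_tuple1 (T : finType) (V : nmodType) (Q : pred (seq T)) (G : seq T -> V) :
  \sum_(xi : 1.-tuple T | Q xi) G xi = \sum_(j | Q [:: j]) G [:: j].
Proof.
rewrite (reindex (fun j => [tuple j])) //=.
exists (fun xi => thead xi) => [j _ //|xi _].
by case/tupleP: xi => j xi; apply/val_inj; rewrite /= (tuple0 xi).
Qed.

Lemma sum_indices1 (V : nmodType) (G : seq 'I_m.+1 -> V) (k : nat) :
  \sum_(xi : 1.-tuple 'I_m.+1 | (size xi + count_mem ord0 xi <= k.+1)%N) G xi =
  (if k is 0%N then 0 else G [:: ord0]) + \sum_(alpha < m) G [:: lift ord0 alpha].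
Proof.
rewrite (sum_tuple1 (fun xi => (size xi + count_mem ord0 xi <= k.+1)%N)) big_mkcond.
by rewrite big_ord_recl /=; congr (_ + _); case: k.
Qed.

Lemma sum_indices0 (V : nmodType) (G : seq 'I_m.+1 -> V) (k : nat) :
  G [::] = 0 ->
  \sum_(xi : 0.-tuple 'I_m.+1 | (size xi + count_mem ord0 xi <= k)%N) G xi = 0.
Proof. by move=> G0; rewrite big1// => xi _; rewrite (tuple0 xi). Qed.

Lemma ito_taylor1 X g z0 (I : multi_index m -> R -> Omega -> R) t w :
  g z0 0 = 0 ->
  ito_taylor 1 X g z0 I t w =
  \sum_(alpha < m) I [:: lift ord0 alpha] t w *: L_one X (lift ord0 alpha) g z0 0.
Proof.
move=> g0; rewrite /ito_taylor big_ord_recl big_ord1.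
rewrite (sum_indices0 (G := fun xi => I xi t w *: L_multi X xi g z0 0)); last first.
  by rewrite /= g0 scaler0.
rewrite (sum_indices1 (fun xi => I xi t w *: L_multi X xi g z0 0)).
by rewrite !add0r.
Qed.

Lemma ito_taylor2 X g z0 (I : multi_index m -> R -> Omega -> R) t w :
  g z0 0 = 0 ->
  ito_taylor 2 X g z0 I t w =
  I [:: ord0] t w *: L_one X ord0 g z0 0 +
  (\sum_(alpha < m) I [:: lift ord0 alpha] t w *: L_one X (lift ord0 alpha) g z0 0 +
   \sum_(xi : 2.-tuple 'I_m.+1 | (size xi + count_mem ord0 xi <= 2)%N)
     I xi t w *: L_multi X xi g z0 0).
Proof.
move=> g0; rewrite /ito_taylor big_ord_recl big_ord_recl big_ord1.
rewrite (sum_indices0 (G := fun xi => I xi t w *: L_multi X xi g z0 0)); last first.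
  by rewrite /= g0 scaler0.
rewrite (sum_indices1 (fun xi => I xi t w *: L_multi X xi g z0 0)).
by rewrite add0r addrA.
Qed.

Lemma noise_index2 (xi : 2.-tuple 'I_m.+1) :
  (size xi + count_mem ord0 xi <= 2)%N ->
  exists alpha beta, val xi = [:: lift ord0 alpha; lift ord0 beta].
Proof.
case/tupleP: xi => a xi; case/tupleP: xi => b xi; rewrite (tuple0 xi) /=.
case: (unliftP ord0 a) => [alpha ->|->//]; case: (unliftP ord0 b) => [beta ->|->//] _.
by exists alpha, beta.
Qed.

Lemma L_one_noise_eq X X' alpha g : diffusion X = diffusion X' ->
  L_one X (lift ord0 alpha) g = L_one X' (lift ord0 alpha) g.
Proof. by move=> XX'; rewrite /L_one liftK XX'. Qed.

End ito_taylor_terms.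

Section generator.
Variables (R : realType) (m : nat).

(** The difference between the Ito and the Stratonovich drift. *)
Definition strat_correction (N : nat) (b : 'I_m -> 'rV[R]_N -> 'rV[R]_N)
    (x : 'rV[R]_N) : 'rV[R]_N :=
  2^-1 *: \sum_(alpha < m) \sum_(j < N) b alpha x 0 j *: partial j (b alpha) x.

Definition ito_second_order (N p : nat) (b : 'I_m -> 'rV[R]_N)
    (G : 'rV[R]_N -> 'rV[R]_p) (z : 'rV[R]_N) : 'rV[R]_p :=
  2^-1 *: \sum_(alpha < m) \sum_(i < N) \sum_(j < N)
    (b alpha 0 i * b alpha 0 j) *: partial i (partial j G) z.

Lemma strat_correctionN (N : nat) (b : 'I_m -> 'rV[R]_N -> 'rV[R]_N) x :
  (forall alpha, differentiable (b alpha) x) ->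
  strat_correction (fun alpha z => - b alpha z) x = strat_correction b x.
Proof.
move=> db; congr (_ *: _); apply: eq_bigr => alpha _; apply: eq_bigr => j _.
have D : partial j (fun z => - b alpha z) x = - partial j (b alpha) x.
  by rewrite /partial deriveN//; exact: diff_derivable.
by rewrite D mxE scaleNr scalerN opprK.
Qed.

Lemma ito_second_orderN (N p : nat) (b : 'I_m -> 'rV[R]_N)
    (G : 'rV[R]_N -> 'rV[R]_p) z :
  ito_second_order (fun alpha => - b alpha) G z = ito_second_order b G z.
Proof.
congr (_ *: _); apply: eq_bigr => alpha _; apply: eq_bigr => i _.
by apply: eq_bigr => j _; rewrite !mxE mulrNN.
Qed.

Variables (r n p : nat) (f : 'rV[R]_r -> 'rV[R]_p) (F : 'rV[R]_n -> 'rV[R]_p).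
Variables (x0 : 'rV[R]_r) (y0 : 'rV[R]_n).
Hypotheses (df : differentiable f x0) (dF : differentiable F y0).
Implicit Types (X : sde R m r) (Y : sde R m n).

Let stack X Y := stack_sde (ito_of_strat X) (ito_of_strat Y).
Let G (z : 'rV[R]_(r + n)) := f (lsubmx z) - F (rsubmx z).

Lemma stack_diff (u : 'rV[R]_r) (v : 'rV[R]_n) :
  \sum_(i < r + n) row_mx u v 0 i *: partial i G (row_mx x0 y0) =
  'd f x0 u - 'd F y0 v.
Proof.
have D := is_diff_sub_stack df dF.
rewrite diff_sum_partial; last exact: ex_diff.
rewrite (congr1 (fun g : _ -> _ => g (row_mx u v)) (@diff_val _ _ _ _ _ _ _ D)).
by rewrite row_mxKl row_mxKr.
Qed.

Lemma L_one_noise X Y alpha :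
  L_one (stack X Y) (lift ord0 alpha) (fun z _ => G z) (row_mx x0 y0) 0 =
  'd f x0 (diffusion X alpha x0 0) - 'd F y0 (diffusion Y alpha y0 0).
Proof. by rewrite /L_one liftK /= -stack_diff row_mxKl row_mxKr. Qed.

(** What [L_(0)] contributes besides the Stratonovich drifts. *)
Definition generator_remainder (b : 'I_m -> 'rV[R]_r -> 'rV[R]_r)
    (B : 'I_m -> 'rV[R]_n -> 'rV[R]_n) : 'rV[R]_p :=
  'd f x0 (strat_correction b x0) - 'd F y0 (strat_correction B y0) +
  ito_second_order (fun alpha => row_mx (b alpha x0) (B alpha y0)) G (row_mx x0 y0).

(** Each of its terms is quadratic in the coefficients [b], [B]. *)
Lemma generator_remainderN b B :
  (forall alpha, differentiable (b alpha) x0) ->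
  (forall alpha, differentiable (B alpha) y0) ->
  generator_remainder (fun alpha z => - b alpha z) (fun alpha z => - B alpha z) =
  generator_remainder b B.
Proof.
move=> db dB; rewrite /generator_remainder !strat_correctionN//; congr (_ + _).
rewrite -[RHS]ito_second_orderN; congr ito_second_order.
by apply/funext => alpha; rewrite opp_row_mx.
Qed.

(** Only the Stratonovich drifts enter linearly, hence with a sign that depends
    on the direction of time; the remainder is quadratic in the diffusions. *)
Lemma L_one_time X Y :
  L_one (stack X Y) ord0 (fun z _ => G z) (row_mx x0 y0) 0 =
  ('d f x0 (drift X x0 0) - 'd F y0 (drift Y y0 0)) +
  generator_remainder (fun alpha z => diffusion X alpha z 0)
                      (fun alpha z => diffusion Y alpha z 0).
Proof.
rewrite /L_one unlift_none derive_cst add0r.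
rewrite /generator_remainder addrA; congr (_ + _); last first.
  by rewrite /ito_second_order /= row_mxKl row_mxKr.
rewrite /= stack_diff row_mxKl row_mxKr.
rewrite -!/(strat_correction (fun alpha z => diffusion _ alpha z 0) _).
by rewrite (linearD ('d f x0)) (linearD ('d F y0)) opprD addrACA.
Qed.

End generator.

(** * Mean squares of the expansions *)

Section expected_squares.
Context (R : realType) d (T : measurableType d) (P : probability T R) (m : nat).
Variables (W : 'I_m -> R -> T -> R) (I : multi_index m -> R -> T -> R).
Hypotheses (HW : is_brownian P W) (HI : is_iterated_ito P W I).
Variable p : nat.

Local Notation L2 := (Lfun P 2%:E).

Lemma expected_sqnormv (z : T -> 'rV[R]_p) :
  (forall i, (fun w => z w 0 i) \in L2) ->
  'E_P[fun w => sqnormv (z w)]%E = (\sum_(i < p) mean P (fun w => z w 0 i ^+ 2))%:E.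
Proof.
move=> z2; rewrite -mean_sum => [|i _]; last exact: (Lfun2_sqr (z2 i)).
rewrite -meanE => [|]; last by apply: Lfun1_sum => i _; exact: (Lfun2_sqr (z2 i)).
by congr ('E_P[_])%E; apply/funext => w; apply: eq_bigr => i _; rewrite expr2.
Qed.

Lemma expected_order1 (v : 'I_m -> 'rV[R]_p) t : 0 < t ->
  'E_P[fun w => sqnormv (\sum_(alpha < m) I [:: lift ord0 alpha] t w *: v alpha)]%E =
  (t * \sum_(alpha < m) sqnormv (v alpha))%:E.
Proof.
move=> t0; have I2 alpha : I [:: lift ord0 alpha] t \in L2.
  by have [] := iterated_centered HW HI [::] alpha (ltW t0).
have zE w i : (\sum_(alpha < m) I [:: lift ord0 alpha] t w *: v alpha) 0 i =
    \sum_(alpha < m) v alpha 0 i * I [:: lift ord0 alpha] t w.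
  by rewrite summxE; apply: eq_bigr => alpha _; rewrite mxE mulrC.
have z2 i : (fun w => (\sum_(alpha < m) I [:: lift ord0 alpha] t w *: v alpha) 0 i) \in L2.
  under eq_fun do rewrite zE.
  by apply: Lfun2_sum => alpha _; exact: Lfun2Z.
rewrite expected_sqnormv//; congr EFin.
rewrite mulr_sumr; under [RHS]eq_bigr do rewrite /sqnormv /dotv mulr_sumr.
rewrite [RHS]exchange_big; apply: eq_bigr => i _ /=.
pose a alpha w := v alpha 0 i * I [:: lift ord0 alpha] t w.
have a2 alpha : a alpha \in L2 by exact: Lfun2Z.
transitivity (mean P (fun w => \sum_(alpha < m) \sum_(beta < m) a alpha w * a beta w)).
  by congr mean; apply/funext => w; rewrite zE expr2 big_distrlr.
rewrite mean_sum => [|alpha _]; last by apply: Lfun1_sum => beta _; exact: Lfun2M.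
apply: eq_bigr => alpha _; rewrite mean_sum => [|beta _]; last exact: Lfun2M.
have E beta : mean P (fun w => a alpha w * a beta w) =
    v alpha 0 i * v beta 0 i * ((alpha == beta)%:R * t).
  rewrite -(iterated_one_cov HW HI alpha beta t0) -meanZ; last exact: Lfun2M.
  by congr mean; apply/funext => w; rewrite /a mulrACA.
rewrite (bigD1 alpha)//= big1 ?addr0 => [|beta ba].
  by rewrite E eqxx mul1r mulrC.
by rewrite E eq_sym (negbTE ba) mul0r mulr0.
Qed.

Lemma expected_order2 (l : 'rV[R]_p) (C : T -> 'rV[R]_p) t : 0 < t ->
  (forall i, (fun w => C w 0 i) \in L2 /\ mean P (fun w => C w 0 i) = 0) ->
  'E_P[fun w => sqnormv (I [:: ord0] t w *: l + C w)]%E =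
  (t ^+ 2 * sqnormv l + \sum_(i < p) mean P (fun w => C w 0 i ^+ 2))%:E.
Proof.
move=> t0 HC; have C2 i := (HC i).1; have C0 i := (HC i).2.
have mC i := Lfun_measurable (C2 i).
have meas (c : T -> R) : measurable_fun setT c ->
    measurable_fun setT (fun w => (sqnormv (c w *: l + C w))%:E).
  move=> mc; apply/measurable_EFinP; apply: measurable_sum => i.
  by apply: measurable_funM; under eq_fun do rewrite !mxE;
    apply: measurable_funD => //; exact: measurable_funM.
transitivity ('E_P[fun w => sqnormv (t *: l + C w)])%E.
  rewrite unlock; apply: ae_eq_integral => //.
  - by apply: meas; exact: (iterated_measurable HI _ (ltW t0)).
  - exact: meas.
  - by apply: filterS (iterated_time HI (ltW t0)) => w /= ->.
have zE w i : (t *: l + C w) 0 i = t * l 0 i + C w 0 i by rewrite !mxE.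
rewrite expected_sqnormv => [|i]; last first.
  under eq_fun do rewrite zE.
  by apply: (Lfun2D (X := cst (t * l 0 i))) => //; exact: Lfun_cst.
congr EFin; rewrite /sqnormv /dotv mulr_sumr -big_split; apply: eq_bigr => i _ /=.
rewrite -expr2 -exprMn -mean_sqr_cst_add//.
by congr mean; apply/funext => w; rewrite zE.
Qed.

End expected_squares.

Lemma L_multi_noise_eq (R : realType) (m N p : nat) (X X' : sde R m N)
    (g : 'rV[R]_N -> R -> 'rV[R]_p) (xi : multi_index m) :
  diffusion X = diffusion X' -> ord0 \notin xi ->
  L_multi X xi g = L_multi X' xi g.
Proof.
move=> XX'; elim: xi => [|j xi IH]; first by [].
rewrite inE negb_or => /andP[j0 xi0].
rewrite -[LHS]/(L_one X j (L_multi X xi g)) -[RHS]/(L_one X' j (L_multi X' xi g)).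
rewrite (IH xi0); case: (unliftP ord0 j) j0 => [alpha ->|->]; last by rewrite eqxx.
by move=> _; exact: L_one_noise_eq.
Qed.

Section expansion_values.
Context (R : realType) d (Omega : measurableType d) (P : probability Omega R).
Context (m r n p : nat).
Variables (f : 'rV[R]_r -> 'rV[R]_p) (F : 'rV[R]_n -> 'rV[R]_p).
Variables (x0 : 'rV[R]_r) (y0 : 'rV[R]_n).
Hypotheses (df : differentiable f x0) (dF : differentiable F y0)
  (fF : f x0 = F y0).
Implicit Types (X : sde R m r) (Y : sde R m n).

Section one_direction.
Variables (W : 'I_m -> R -> Omega -> R) (I : multi_index m -> R -> Omega -> R).
Hypotheses (HW : is_brownian P W) (HI : is_iterated_ito P W I).

Local Notation stack X Y := (stack_sde (ito_of_strat X) (ito_of_strat Y)).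
Local Notation g := (fun (z : 'rV[R]_(r + n)) (_ : R) => f (lsubmx z) - F (rsubmx z)).

Let g0 : g (row_mx x0 y0) 0 = 0.
Proof. by rewrite /= row_mxKl row_mxKr fF subrr. Qed.

Lemma expected_expansion1 X Y t : 0 < t ->
  'E_P[fun w => sqnormv (z_expansion 1 X Y f F x0 y0 I t w)]%E =
  (t * \sum_(alpha < m) sqnormv ('d f x0 (diffusion X alpha x0 0) -
                                 'd F y0 (diffusion Y alpha y0 0)))%:E.
Proof.
move=> t0; rewrite -(expected_order1 HW HI _ t0); congr ('E_P[_])%E.
apply/funext => w; congr sqnormv; rewrite /z_expansion ito_taylor1//.
by apply: eq_bigr => alpha _; rewrite L_one_noise.
Qed.

(** The terms of the order 1 expansion whose multi-index has no zero. *)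
Definition expansion_noise X Y t (w : Omega) : 'rV[R]_p :=
  \sum_(alpha < m) I [:: lift ord0 alpha] t w *:
    L_one (stack X Y) (lift ord0 alpha) g (row_mx x0 y0) 0 +
  \sum_(xi : 2.-tuple 'I_m.+1 | (size xi + count_mem ord0 xi <= 2)%N)
    I xi t w *: L_multi (stack X Y) xi g (row_mx x0 y0) 0.

Lemma expansion_noise_centered X Y t i : 0 <= t ->
  (fun w => expansion_noise X Y t w 0 i) \in Lfun P 2%:E /\
  mean P (fun w => expansion_noise X Y t w 0 i) = 0.
Proof.
move=> t0.
have E w : expansion_noise X Y t w 0 i =
    \sum_(alpha < m) L_one (stack X Y) (lift ord0 alpha) g (row_mx x0 y0) 0 0 i *
      I [:: lift ord0 alpha] t w +
    \sum_(xi : 2.-tuple 'I_m.+1 | (size xi + count_mem ord0 xi <= 2)%N)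
      L_multi (stack X Y) xi g (row_mx x0 y0) 0 0 i * I xi t w.
  by rewrite mxE !summxE; congr (_ + _); apply: eq_bigr => j _; rewrite mxE mulrC.
under eq_fun do rewrite E.
have I1 alpha := iterated_centered HW HI [::] alpha t0.
have I2 (xi : 2.-tuple 'I_m.+1) : (size xi + count_mem ord0 xi <= 2)%N ->
    I xi t \in Lfun P 2%:E /\ mean P (I xi t) = 0.
  move=> /noise_index2[alpha [beta ->]].
  exact: (iterated_centered HW HI [:: lift ord0 alpha] beta t0).
have S1 : (fun w => \sum_(alpha < m)
    L_one (stack X Y) (lift ord0 alpha) g (row_mx x0 y0) 0 0 i *
    I [:: lift ord0 alpha] t w) \in Lfun P 2%:E.
  by apply: Lfun2_sum => alpha _; apply: Lfun2Z; have [] := I1 alpha.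
have S2 : (fun w => \sum_(xi : 2.-tuple 'I_m.+1 | (size xi + count_mem ord0 xi <= 2)%N)
      L_multi (stack X Y) xi g (row_mx x0 y0) 0 0 i * I xi t w) \in Lfun P 2%:E.
  by apply: Lfun2_sum => xi /I2[I2xi _]; exact: Lfun2Z.
split; first exact: Lfun2D.
rewrite meanD ?Lfun2_Lfun1// !mean_sum.
- rewrite !big1 ?addr0// => [xi /I2[I2xi mxi]|alpha _].
    by rewrite meanZ ?mxi ?mulr0//; exact: Lfun2_Lfun1.
  have [I1a m1] := I1 alpha; rewrite meanZ; last exact: Lfun2_Lfun1.
  by rewrite [mean _ _]m1 mulr0.
- by move=> xi /I2[I2xi _]; apply: Lfun1Z; exact: Lfun2_Lfun1.
- by move=> alpha _; apply: Lfun1Z; apply: Lfun2_Lfun1; have [] := I1 alpha.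
Qed.

(** The drift enters only through the operator [L_(0)]. *)
Lemma expansion_noise_eq X Y Y' t w : diffusion Y = diffusion Y' ->
  expansion_noise X Y t w = expansion_noise X Y' t w.
Proof.
move=> YY'; have S : diffusion (stack X Y) = diffusion (stack X Y').
  by rewrite /= YY'.
congr (_ + _); first by apply: eq_bigr => alpha _; rewrite (L_one_noise_eq _ _ S).
apply: eq_bigr => xi xi2; rewrite (L_multi_noise_eq _ S)//.
by have [alpha [beta ->]] := noise_index2 xi2.
Qed.

Definition noise_square X Y t : R :=
  \sum_(i < p) mean P (fun w => expansion_noise X Y t w 0 i ^+ 2).

Lemma noise_square_eq X Y Y' t : diffusion Y = diffusion Y' ->
  noise_square X Y t = noise_square X Y' t.
Proof.
move=> YY'; apply: eq_bigr => i _; congr mean; apply/funext => w.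
by rewrite (expansion_noise_eq _ _ _ YY').
Qed.

Lemma expected_expansion2 X Y t : 0 < t ->
  'E_P[fun w => sqnormv (z_expansion 2 X Y f F x0 y0 I t w)]%E =
  (t ^+ 2 * sqnormv ('d f x0 (drift X x0 0) - 'd F y0 (drift Y y0 0) +
     generator_remainder f F x0 y0 (fun alpha z => diffusion X alpha z 0)
                                   (fun alpha z => diffusion Y alpha z 0)) +
   noise_square X Y t)%:E.
Proof.
move=> t0; rewrite -(L_one_time df dF).
rewrite -(expected_order2 HI _ t0); last first.
  by move=> i; apply: expansion_noise_centered; exact: ltW.
congr ('E_P[_])%E; apply/funext => w; congr sqnormv.
by rewrite /z_expansion ito_taylor2.
Qed.

End one_direction.

Variables (W What : 'I_m -> R -> Omega -> R)
  (I Ihat : multi_index m -> R -> Omega -> R).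
Hypotheses (HW : is_brownian P W) (HI : is_iterated_ito P W I).
Hypotheses (HWhat : is_brownian P What) (HIhat : is_iterated_ito P What Ihat).

Lemma S_half1E X Y t0 t : 0 < t ->
  S_half P I Ihat f F x0 y0 t0 1 X Y t =
  (t * \sum_(alpha < m) sqnormv ('d f x0 (diffusion X alpha x0 t0) -
                                 'd F y0 (diffusion Y alpha y0 t0)))%:E.
Proof.
move=> t_gt0; rewrite /S_half.
rewrite (expected_expansion1 HW HI _ _ t_gt0).
rewrite (expected_expansion1 HWhat HIhat _ _ t_gt0).
rewrite /= oppr0 addr0.
have E alpha : sqnormv ('d f x0 (- diffusion X alpha x0 t0) -
    'd F y0 (- diffusion Y alpha y0 t0)) =
    sqnormv ('d f x0 (diffusion X alpha x0 t0) - 'd F y0 (diffusion Y alpha y0 t0)).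
  rewrite (linearN ('d f x0)) (linearN ('d F y0)) -opprD.
  by rewrite /sqnormv dotvNl dotvC dotvNl opprK.
under [X in (_ + _ * (t * X)%:E)%E]eq_bigr do rewrite E.
by rewrite -!EFinM -EFinD !(mulrC 2^-1) -splitr.
Qed.

(** The remainder is the same in both directions of time while the term in the
    Stratonovich drifts changes sign, so that the parallelogram law separates
    the two. *)
Lemma S_half2E X Y t0 t : 0 < t ->
  (forall alpha, differentiable (fun z => diffusion X alpha z t0) x0) ->
  (forall alpha, differentiable (fun z => diffusion Y alpha z t0) y0) ->
  exists K : R, forall A' : 'rV[R]_n -> R -> 'rV[R]_n,
    S_half P I Ihat f F x0 y0 t0 2 X (Sde A' (diffusion Y)) t =
    (t ^+ 2 * sqnormv ('d f x0 (drift X x0 t0) - 'd F y0 (A' y0 t0)) + K)%:E.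
Proof.
move=> t_gt0 dX dY.
pose c := generator_remainder f F x0 y0 (fun alpha z => diffusion X alpha z t0)
                                        (fun alpha z => diffusion Y alpha z t0).
pose Xs := shift_sde t0 X; pose Ys := shift_sde t0 Y.
pose K1 := noise_square I Xs Ys t.
pose K2 := noise_square Ihat (reverse_sde Xs) (reverse_sde Ys) t.
exists (t ^+ 2 * sqnormv c + 2^-1 * (K1 + K2)) => A'.
rewrite /S_half.
rewrite (expected_expansion2 HW HI _ _ t_gt0).
rewrite (expected_expansion2 HWhat HIhat _ _ t_gt0).
pose YA := Sde A' (diffusion Y).
rewrite -/YA (noise_square_eq I Xs t (_ : diffusion (shift_sde t0 YA) = diffusion Ys))//.
rewrite (noise_square_eq Ihat (reverse_sde Xs) t
  (_ : diffusion (reverse_sde (shift_sde t0 YA)) = diffusion (reverse_sde Ys)))//.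
rewrite -/K1 -/K2.
rewrite /= oppr0 addr0 (generator_remainderN f F dX dY) -/c.
rewrite (linearN ('d f x0)) (linearN ('d F y0)) -opprD.
set u := _ - _; rewrite -!EFinM -EFinD; congr EFin.
have := sqnormv_reflect u c; set a := sqnormv (u + c); set b := sqnormv (- u + c).
move=> ab; transitivity (t ^+ 2 * (2^-1 * (a + b)) + 2^-1 * (K1 + K2)); first by ring.
rewrite ab; by field.
Qed.

End expansion_values.

(** * Optimality *)

Section optimality.
Context (R : realType) d (Omega : measurableType d) (P : probability Omega R).
Context (m r n p : nat).
Variables (W What : 'I_m -> R -> Omega -> R)
  (I Ihat : multi_index m -> R -> Omega -> R).
Hypotheses (HW : is_brownian P W) (HI : is_iterated_ito P W I).
Hypotheses (HWhat : is_brownian P What) (HIhat : is_iterated_ito P What Ihat).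

Lemma residual_le (L : {linear 'rV[R]_n -> 'rV[R]_p}) (e : 'rV[R]_p)
    (b0 b : 'rV[R]_n) : (forall w, dotv (e - L b0) (L w) = 0) ->
  sqnormv (e - L b0) <= sqnormv (e - L b).
Proof. by move=> res; rewrite (sqnormv_residual b res) lerDl sqnormv_ge0. Qed.

Lemma residual_unique (L : {linear 'rV[R]_n -> 'rV[R]_p}) (e : 'rV[R]_p)
    (b0 b : 'rV[R]_n) : (forall w, dotv (e - L b0) (L w) = 0) ->
  (forall w, L w = 0 -> w = 0) ->
  sqnormv (e - L b) <= sqnormv (e - L b0) -> b = b0.
Proof.
move=> res inj; rewrite (sqnormv_residual b res) gerDl => /sqnormv_le0/inj/eqP.
by rewrite subr_eq0 => /eqP.
Qed.

Variables (M U : set 'rV[R]_r) (psi : 'rV[R]_r -> 'rV[R]_n)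
  (phi : 'rV[R]_n -> 'rV[R]_r) (J : set R) (X : sde R m r).
Hypotheses (HX : admissible setT J X)
  (Hproj : admissible (psi @` U) J (strat_projection M psi phi X))
  (phiK : forall x, U x -> phi (psi x) = x).

(** The common form of the two cases: [chart_proj M psi x v] solves the
    least-squares problem for [v], uniquely as ['d F (psi x)] is injective.  The
    projection itself serves as competitor in both minimizations. *)
Lemma residual_optimal (f : 'rV[R]_r -> 'rV[R]_p) (F : 'rV[R]_n -> 'rV[R]_p) :
  (forall x, U x -> [/\ f x = F (psi x), differentiable f x,
     differentiable F (psi x),
     forall v w, dotv ('d f x v - 'd F (psi x) (chart_proj M psi x v))
                      ('d F (psi x) w) = 0
   & forall w, 'd F (psi x) w = 0 -> w = 0]) ->
  strat_projection_optimal P I Ihat M U psi phi J X f F.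
Proof.
move=> H V S proj; split; first exact: Hproj.
- move=> Y x0 t0 t HY Ux0 Jt0 t_gt0; rewrite {}/S {}/proj.
  have [fF df dF res inj] := H x0 Ux0.
  have Vx0 : (psi @` U) (psi x0) by exists x0.
  pose e alpha := 'd f x0 (diffusion X alpha x0 t0).
  pose b0 alpha := chart_proj M psi x0 (diffusion X alpha x0 t0).
  have projE alpha :
      diffusion (strat_projection M psi phi X) alpha (psi x0) t0 = b0 alpha.
    by rewrite /= phiK.
  have SE (Y' : sde R m n) : S_half P I Ihat f F x0 (psi x0) t0 1 X Y' t =
      (t * \sum_(alpha < m)
        sqnormv (e alpha - 'd F (psi x0) (diffusion Y' alpha (psi x0) t0)))%:E.
    exact: S_half1E HW HI HWhat HIhat _ _ _ _ t_gt0.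
  split=> [Ymin alpha|YE Y' _].
    have := Ymin _ Hproj; rewrite !SE lee_fin ler_pM2l// projE.
    under [X in _ <= X]eq_bigr do rewrite projE.
    rewrite (bigD1 alpha)//= [X in _ <= X](bigD1 alpha)//= => le_sum.
    apply: (residual_unique (res _) inj); rewrite -/(e alpha) -/(b0 alpha).
    rewrite leNgt; apply/negP => lt_alpha; move: le_sum; apply/negP; rewrite -ltNge.
    by apply: ltr_leD => //; apply: ler_sum => beta _; exact: residual_le (res _).
  rewrite !SE lee_fin ler_pM2l//; apply: ler_sum => alpha _.
  by rewrite YE projE; exact: residual_le (res _).
- move=> Y x0 t0 t HY _ Ux0 Jt0 t_gt0; rewrite {}/S {}/proj.
  have [fF df dF res inj] := H x0 Ux0.
  have Vx0 : (psi @` U) (psi x0) by exists x0.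
  have projE : drift (strat_projection M psi phi X) (psi x0) t0 =
      chart_proj M psi x0 (drift X x0 t0) by rewrite /= phiK.
  have [K SE] := S_half2E df dF fF HW HI HWhat HIhat t_gt0
    (fun alpha => HX alpha Jt0 (Logic.I : setT x0))
    (fun alpha => HY alpha _ _ Jt0 Vx0).
  have YE : Y = Sde (drift Y) (diffusion Y) by case: (Y).
  have t2 : 0 < t ^+ 2 by rewrite exprn_gt0.
  rewrite [in X in X <-> _]YE; split=> [Ymin|AE A'].
    have := Ymin (drift (strat_projection M psi phi X)).
    rewrite !SE lee_fin lerD2r ler_pM2l// projE.
    exact: residual_unique (res _) inj.
  rewrite !SE lee_fin lerD2r ler_pM2l// AE projE.
  exact: residual_le (res _).
Qed.

End optimality.

Theorem mainTheorem4
  (R : realType) (d : measure_display) (Omega : measurableType d)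
  (P : probability Omega R) (m r n : nat)
  (W What : 'I_m -> R -> Omega -> R)
  (HW : is_brownian P W) (HWhat : is_brownian P What)
  (Hindep : independent_processes P W What)
  (I Ihat : multi_index m -> R -> Omega -> R)
  (HI : is_iterated_ito P W I) (HIhat : is_iterated_ito P What Ihat)
  (M U N : set 'rV[R]_r) (psi : 'rV[R]_r -> 'rV[R]_n)
  (phi : 'rV[R]_n -> 'rV[R]_r) (Pis : 'rV[R]_r -> 'rV[R]_r)
  (HM : is_submanifold n M) (Hchart : is_chart M U psi phi)
  (HPis : is_metric_projection M U N Pis)
  (J : set R) (HJ : open J)
  (X : sde R m r) (HX : admissible setT J X) :
  strat_projection_optimal P I Ihat M U psi phi J X id phi /\
  strat_projection_optimal P I Ihat M U psi phi J X (psi \o Pis) id.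
Proof.
have phiK x : U x -> phi (psi x) = x := chart_phiK Hchart (x := x).
have Hproj := strat_projection_admissible Hchart HPis HX.
split; apply: (residual_optimal HW HI HWhat HIhat HX Hproj phiK) => x Ux;
  have [dP PE res inj _] := chart_projP Hchart HPis Ux.
- have idE v : 'd (@id 'rV[R]_r) x v = v by rewrite diff_val.
  split=> //.
  + by rewrite phiK.
  + by apply: (chart_phi_differentiable Hchart); exists x.
  + by move=> v w; rewrite idE.
- have idE v : 'd (@id 'rV[R]_n) (psi x) v = v by rewrite diff_val.
  split=> //.
  + by rewrite /= (metric_projection_id Hchart HPis).
  + move=> v w; rewrite PE idE subrr /dotv big1// => i _.
    by rewrite mxE mul0r.
  + by move=> w; rewrite idE.
Qed.
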